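(* Let $R$ be a finite ring and $K$ a field. The following are equivalent: (1) the unitary Cayley graph $\Gamma(R)$ is Cohen–Macaulay over $K$; (2) $\Gamma(R)$ is well-covered and shellable; (3) either $R$ is a field or $R\cong \mathbb{Z}_2^k$ for some positive integer $k$.
   Context: All rings are finite, associative, with a nonzero identity. The unitary Cayley graph $\Gamma(R)$ has vertex set $R$, with distinct $x,y$ adjacent iff $x-y$ is a unit of $R$. A graph is well-covered if all its maximal independent sets have the same size. For a graph $G$ on vertex set $[N]$, its edge ideal is $I(G)=\langle x_ix_j : \{i,j\}\in E(G)\rangle\subseteq S=K[x_1,\dots,x_N]$, and $G$ is Cohen–Macaulay over $K$ if $S/I(G)$ is a Cohen–Macaulay ring. The independence complex $\mathrm{Ind}(G)$ is the simplicial complex of independent sets of $G$. A simplicial complex is shellable if its facets can be ordered $F_1,\dots,F_t$ so that for each $i>1$ the complex $\langle F_1,\dots,F_{i-1}\rangle\cap\langle F_i\rangle$ (where $\langle\cdot\rangle$ denotes the complex generated by the listed facets) is pure of dimension $\dim F_i-1$; a graph is shellable if its independence complex is. *)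

(* Defs.v *)
From HB Require Import structures.
From mathcomp Require Import all_boot all_order all_algebra.
From mathcomp Require Import ring_quotient boolp mpoly.

Set Implicit Arguments.
Unset Strict Implicit.
Unset Printing Implicit Defensive.

Import GRing.Theory.

Local Open Scope ring_scope.

Section Ideals.
Variable A : comNzRingType.

Definition in_span (gs : seq A) (a : A) : Prop :=
  exists c : 'I_(size gs) -> A, a = \sum_(i < size gs) c i * gs`_i.

(* [idealr_closed] includes properness, so only proper ideals are tested; the
   unit ideal is always finitely generated. *)
Definition noetherian : Prop :=
  forall I : {pred A}, idealr_closed I ->
    exists gs : seq A, forall a, a \in I <-> in_span gs a.

Definition prime_ideal (P : {pred A}) : Prop :=
  idealr_closed P /\ prime_idealr_closed P.

Definition maximal_ideal (M : {pred A}) : Prop :=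
  idealr_closed M /\
  forall J : {pred A}, idealr_closed J -> {subset M <= J} -> {subset J <= M}.

Definition regular_seq (s : seq A) : Prop :=
  (forall i, (i < size s)%N -> forall a,
     in_span (take i s) (s`_i * a) -> in_span (take i s) a) /\
  ~ in_span s 1.

Definition regular_seq_in (I : {pred A}) (s : seq A) : Prop :=
  regular_seq s /\ {subset s <= I}.

Definition has_depth (I : {pred A}) (d : nat) : Prop :=
  (exists2 s, regular_seq_in I s & size s = d) /\
  (forall s, regular_seq_in I s -> (size s <= d)%N).

(* Only the values P 0 < P 1 < ... < P d matter. *)
Definition prime_chain_in (I : {pred A}) (d : nat) (P : nat -> {pred A}) : Prop :=
  [/\ forall i, (i <= d)%N -> prime_ideal (P i),
      forall i, (i < d)%N ->
        {subset P i <= P i.+1} /\ ~ {subset P i.+1 <= P i}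
    & {subset P d <= I}].

(* The codimension (height) of a prime I. *)
Definition has_codim (I : {pred A}) (d : nat) : Prop :=
  (exists P, prime_chain_in I d P) /\
  (forall d' P, prime_chain_in I d' P -> (d' <= d)%N).

(* Textbook definition without localizations (Eisenbud, Commutative Algebra,
   18.2; Kaplansky, Commutative Rings, 3-1): depth M = codim M for every
   maximal ideal M, where depth M is the maximal length of a regular sequence
   of A in M.  Both numbers are finite when A is noetherian. *)
Definition cohen_macaulay : Prop :=
  noetherian /\
  forall M : {pred A}, maximal_ideal M ->
    exists2 d, has_depth M d & has_codim M d.

End Ideals.

Section Complexes.
Variable T : finType.
Implicit Types (D : {set {set T}}) (F : {set T}).

Definition facet D F : bool := maxset [pred G | G \in D] F.

Definition generated_complex (s : seq {set T}) : {set {set T}} :=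
  [set F : {set T} | has (fun G : {set T} => F \subset G) s].

(* The empty face has dimension -1. *)
Definition face_dim F : int := #|F|%:Z - 1.

Definition pure_of_dim D (d : int) : Prop :=
  forall F, facet D F -> face_dim F = d.

Definition shellable D : Prop :=
  exists s : seq {set T},
    [/\ uniq s,
        forall F, (F \in s) = facet D F
      & forall i, (0 < i < size s)%N ->
          let Fi := nth set0 s i in
          pure_of_dim
            (generated_complex (take i s) :&: generated_complex [:: Fi])
            (face_dim Fi - 1)].

End Complexes.

Section Graphs.
Variables (T : finType) (e : rel T).

Definition independent (A : {set T}) : bool :=
  [forall x in A, forall y in A, ~~ e x y].

Definition Ind : {set {set T}} := [set A | independent A].

Definition well_covered : Prop :=
  forall A B : {set T},
    maxset independent A -> maxset independent B -> #|A| = #|B|.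

Definition shellable_graph : Prop := shellable Ind.

Section EdgeIdeal.
Variable K : fieldType.

(* One variable x_v per vertex v, numbered through [enum_rank]. *)
Definition vertex_var (v : T) : {mpoly K[#|T|]} := 'X_(enum_rank v).

Definition edge_monomials : seq {mpoly K[#|T|]} :=
  [seq vertex_var p.1 * vertex_var p.2 | p in [pred p : T * T | e p.1 p.2]].

Definition edge_ideal : {pred {mpoly K[#|T|]}} :=
  fun f => `[< in_span edge_monomials f >].

Lemma edge_ideal_closed : idealr_closed edge_ideal.
Proof.
split.
- apply/asboolP; exists (fun=> 0); by rewrite big1 // => i _; rewrite mul0r.
- apply/asboolP => -[c /(congr1 (meval (fun=> 0)))] /eqP.
  rewrite rmorph1 rmorph_sum /= big1 ?oner_eq0 // => i _.
  have /mapP[p _ ->] := mem_nth 0 (ltn_ord i).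
  by rewrite !rmorphM /= mevalXU mul0r mulr0.
- move=> a u v /asboolP[c ->] /asboolP[d ->]; apply/asboolP.
  exists (fun i => a * c i + d i).
  rewrite mulr_sumr -big_split /=; apply: eq_bigr => i _.
  by rewrite mulrA -mulrDl.
Qed.

HB.instance Definition _ :=
  isIdealr.Build {mpoly K[#|T|]} edge_ideal edge_ideal_closed.

Definition edge_ring : comNzRingType := {ideal_quot edge_ideal}.

Definition cohen_macaulay_graph : Prop := cohen_macaulay edge_ring.

End EdgeIdeal.

End Graphs.
Arguments edge_ideal {T} e K.

(* On a finite ring the [finUnitRingType] structure is no extra datum:
   [GRing.unit] is the set of two-sided invertible elements. *)
Definition unitary_cayley (R : finUnitRingType) : rel R :=
  [rel x y | (x != y) && (x - y \is a GRing.unit)].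
Arguments unitary_cayley R : clear implicits.

Definition is_field (R : unitRingType) : Prop :=
  commutative (@GRing.mul R) /\
  forall x : R, x != 0 -> x \is a GRing.unit.

Definition ring_isomorphic (R S : pzRingType) : Prop :=
  exists f : {rmorphism R -> S}, bijective f.

(* Main.v *)
(** Both conditions (1) and (2) imply an exchange property: for every maximal
    independent set F there are a in F and b outside F such that a is the only
    neighbour of b in F.  For a shelling of a pure complex this is immediate.
    For a Cohen-Macaulay graph, take b with fewest neighbours in F and let G be
    the set of elements of F not adjacent to b; if b had two neighbours, the link
    of G would be disconnected of positive dimension, which is excluded by the
    vanishing of Koszul cohomology, in degrees below the depth, at the point
    whose coordinates are 1 on G and 0 elsewhere (Hartshorne connectedness).

    In the unitary Cayley graph of R, exchange inside a maximal independent set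
    which is a union of cosets of a proper left ideal L gives a unit u such that
    1 - l u is a unit only for l = 0, for l in L.  Then every element of L u is
    idempotent, and R is a division ring or a Boolean ring.

    Conversely the graphs of (3) are disjoint unions of cliques.  Their maximal
    independent sets are the transversals, shelled by increasing weight.  With m
    cliques, the edge ring has Krull dimension and all depths at most m because
    its filtration by degree grows like N^m, so that m + 1 elements satisfy an
    algebraic relation.  By Zariski's lemma every residue field is algebraic over
    K; this yields prime chains of length m below each maximal ideal M, and
    regular sequences p_i(t_i) in M, where t_i is the sum of the i-th clique. *)
Require Import Defs.
From HB Require Import structures.
From mathcomp Require Import all_boot all_order all_algebra finfield.
From mathcomp Require Import generic_quotient ring_quotient boolp mpoly.
From mathcomp Require Import ring zify.

Set Implicit Arguments.
Unset Strict Implicit.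
Unset Printing Implicit Defensive.

Import GRing.Theory.

Local Open Scope ring_scope.

(** * Ideals and edge rings *)

Section Spans.
Variable A : comNzRingType.
Implicit Types (I : A -> Prop) (s gs : seq A) (a b : A).

(** Unlike [idealr_closed], this admits the unit ideal, so that every span is an ideal. *)
Definition is_ideal I : Prop :=
  [/\ I 0, forall a b, I a -> I b -> I (a + b) & forall a b, I b -> I (a * b)].

Lemma ideal_sum I (J : Type) (r : seq J) (P : pred J) (F : J -> A) :
  is_ideal I -> (forall j, P j -> I (F j)) -> I (\sum_(j <- r | P j) F j).
Proof. by case=> I0 ID _ IF; apply: big_ind. Qed.

Lemma ideal_opp I a : is_ideal I -> I a -> I (- a).
Proof. by case=> _ _ IM Ia; rewrite -mulN1r; apply: IM. Qed.

Lemma ideal_sub I a b : is_ideal I -> I a -> I b -> I (a - b).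
Proof.
by move=> II Ia Ib; case: (II) => _ ID _; apply: ID => //; apply: ideal_opp.
Qed.

Lemma ideal_mulr I a b : is_ideal I -> I a -> I (a * b).
Proof. by case=> _ _ IM Ia; rewrite mulrC; apply: IM. Qed.

Lemma span_ideal gs : is_ideal (in_span gs).
Proof.
split.
- by exists (fun=> 0); rewrite big1 // => i _; rewrite mul0r.
- move=> a b [c ->] [d ->]; exists (fun i => c i + d i).
  by rewrite -big_split; apply: eq_bigr => i _; rewrite mulrDl.
- move=> a b [c ->]; exists (fun i => a * c i).
  by rewrite mulr_sumr; apply: eq_bigr => i _; rewrite mulrA.
Qed.

Lemma mem_span gs a : a \in gs -> in_span gs a.
Proof.
move=> ags; have lt := ags; rewrite -index_mem in lt.
exists (fun i => (i == Ordinal lt)%:R).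
rewrite (bigD1 (Ordinal lt)) //= eqxx mul1r nth_index // big1 ?addr0 // => i.
by move/negPf->; rewrite mul0r.
Qed.

Lemma span_sub I gs a :
  is_ideal I -> {in gs, forall g, I g} -> in_span gs a -> I a.
Proof.
move=> II Ig [c ->]; apply: ideal_sum => // i _.
by case: II => _ _ IM; apply/IM/Ig/mem_nth.
Qed.

Lemma span_rcons s t a :
  in_span (rcons s t) a <-> exists c, in_span s (a - t * c).
Proof.
have [H0 HD HM] := span_ideal (rcons s t); split.
  have [I0 ID IM] := span_ideal s.
  apply: (@span_sub (fun a => exists c, in_span s (a - t * c))) => [|g].
    split.
    - by exists 0; rewrite mulr0 subr0.
    - move=> x y [c xc] [d yd]; exists (c + d).
      by rewrite (_ : _ - _ = (x - t * c) + (y - t * d)); [apply: ID | ring].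
    - move=> x y [c yc]; exists (x * c).
      by rewrite (_ : _ - _ = x * (y - t * c)); [apply: IM | ring].
  rewrite mem_rcons inE => /predU1P[->|gs].
    by exists 1; rewrite mulr1 subrr.
  by exists 0; rewrite mulr0 subr0; apply: mem_span.
case=> c cs; rewrite -(subrK (t * c) a); apply: HD.
  apply: span_sub (span_ideal _) _ cs => g gs; apply: mem_span.
  by rewrite mem_rcons inE gs orbT.
by rewrite mulrC; apply: HM; apply: mem_span; rewrite mem_rcons mem_head.
Qed.

Lemma span_cat_sub s1 s2 a : {subset s1 <= s2} -> in_span s1 a -> in_span s2 a.
Proof.
move=> sub; apply: span_sub; first exact: span_ideal.
by move=> g /sub; apply: mem_span.
Qed.

Lemma idealr_closed_ideal (I : {pred A}) :
  idealr_closed I -> is_ideal (fun a => a \in I).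
Proof.
move=> Ic; have [I0 I1 IM] := Ic; split=> // [a b Ia Ib|a b Ib].
  by have := IM 1 _ _ Ia Ib; rewrite mul1r.
by have := IM a _ _ Ib I0; rewrite addr0.
Qed.

Lemma ideal_idealr_closed I :
  is_ideal I -> ~ I 1 -> idealr_closed (fun a => `[< I a >]).
Proof.
case=> I0 ID IM I1; split; first exact/asboolP.
  by apply/asboolP.
by move=> a u v /asboolP Iu /asboolP Iv; apply/asboolP/ID => //; apply: IM.
Qed.

(** Otherwise [J], the sum of [M] and the multiples of [a], would be a proper ideal strictly larger
    than [M]. *)
Lemma maximal_ideal_inv (M : {pred A}) a :
  maximal_ideal M -> a \notin M -> exists c, 1 - a * c \in M.
Proof.
case=> Mc Mmax aM; have [M0 MD MM] := idealr_closed_ideal Mc.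
apply: contrapT => nex.
pose J x := exists c, x - a * c \in M.
have JI : is_ideal J.
  split.
  - by exists 0; rewrite mulr0 subr0.
  - move=> x y [c xc] [d yd]; exists (c + d).
    by rewrite (_ : _ - _ = (x - a * c) + (y - a * d)); [apply: MD | ring].
  - move=> x y [c yc]; exists (x * c).
    by rewrite (_ : _ - _ = x * (y - a * c)); [apply: MM | ring].
have/Mmax sub := ideal_idealr_closed JI nex.
move/negP: aM; apply; apply: sub.
  by move=> x xM; apply/asboolP; exists 0; rewrite mulr0 subr0.
by apply/asboolP; exists 1; rewrite mulr1 subrr.
Qed.

End Spans.

Section EdgeRing.
Variables (T : finType) (e : rel T) (K : fieldType).
Local Notation S := {mpoly K[#|T|]}.
Local Notation A := (edge_ring e K).

Definition edge_proj : {rmorphism S -> A} := \pi_A%qT.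

(* Opaque, so that simplification does not expose the quotient map. *)
Fact edge_const_subproof :
  {f : {rmorphism K -> A} | forall k, f k = edge_proj k%:MP}.
Proof. by exists (edge_proj \o @mpolyC _ K). Qed.

Definition edge_const : {rmorphism K -> A} := sval edge_const_subproof.

Lemma edge_constE k : edge_const k = edge_proj k%:MP.
Proof. exact: (svalP edge_const_subproof). Qed.

Definition edge_var (v : T) : A := edge_proj (vertex_var K v).

Lemma edge_proj_surj (a : A) : exists p, a = edge_proj p.
Proof. by exists (repr a); rewrite /edge_proj /= reprK. Qed.

Lemma edge_proj_eq0 p : edge_proj p = 0 <-> in_span (edge_monomials e K) p.
Proof.
rewrite -[X in _ = X](rmorph0 edge_proj) /edge_proj /=.
transitivity (p \in edge_ideal e K); last by split=> /asboolP.
by rewrite -[X in X \in _]subr0 Quotient.idealrBE; split=> /eqP.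
Qed.

Lemma edge_var_mul u v : e u v -> edge_var u * edge_var v = 0.
Proof.
move=> euv; rewrite /edge_var -rmorphM; apply/edge_proj_eq0/mem_span.
by apply/imageP; exists (u, v).
Qed.

Lemma edge_ring_ind (P : A -> Prop) :
  (forall c, P (edge_const c)) -> (forall v, P (edge_var v)) ->
  (forall a b, P a -> P b -> P (a + b)) ->
  (forall a b, P a -> P b -> P (a * b)) -> forall a, P a.
Proof.
move=> Pc Px PD PM a; have [p ->] := edge_proj_surj a.
have P0 : P 0 by rewrite -(rmorph0 edge_const).
have P1 : P 1 by rewrite -(rmorph1 edge_const).
have PX (b : A) k : P b -> P (b ^+ k).
  by move=> Pb; elim: k => [|k IHk]; rewrite ?expr0 // exprS; apply: PM.
rewrite [p]mpolyE rmorph_sum; apply: (big_ind P P0 PD) => m _.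
rewrite -mul_mpolyC rmorphM; apply: (PM); first by rewrite -edge_constE.
rewrite mpolyXE_id rmorph_prod; apply: (big_ind P P1 PM) => i _.
by rewrite rmorphXn; apply: PX; rewrite -[i]enum_valK; apply: Px.
Qed.

Section Lift.
Variables (C : comNzRingType) (k : {rmorphism K -> C}) (g : T -> C).
Hypothesis g_mul : forall u v, e u v -> g u * g v = 0.

Let lift_mpoly : S -> C := mmap k (g \o enum_val).

Let lift_mpoly_kernel p : edge_proj p = 0 -> lift_mpoly p = 0.
Proof.
move/edge_proj_eq0; apply: (@span_sub _ (fun q => lift_mpoly q = 0)).
  split=> [|a b a0 b0|a b b0]; rewrite /lift_mpoly.
  - exact: rmorph0.
  - by rewrite rmorphD /= [X in X + _]a0 [X in _ + X]b0 addr0.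
  - by rewrite rmorphM /= [X in _ * X]b0 mulr0.
move=> _ /imageP[[u v] euv ->]; rewrite /lift_mpoly rmorphM /=.
by rewrite !mmapX !mmap1U /= !enum_rankK g_mul.
Qed.

Let lift (a : A) : C := lift_mpoly (repr a).

Let liftE p : lift (edge_proj p) = lift_mpoly p.
Proof.
apply/eqP; rewrite -subr_eq0 -rmorphB; apply/eqP/lift_mpoly_kernel.
by rewrite rmorphB /edge_proj /= reprK subrr.
Qed.

Let lift_zmod_morphism : zmod_morphism lift.
Proof.
move=> a b; have [p ->] := edge_proj_surj a; have [q ->] := edge_proj_surj b.
by rewrite -rmorphB !liftE /lift_mpoly rmorphB.
Qed.

Let lift_monoid_morphism : monoid_morphism lift.
Proof.
split; first by rewrite -(rmorph1 edge_proj) liftE /lift_mpoly rmorph1.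
move=> a b; have [p ->] := edge_proj_surj a; have [q ->] := edge_proj_surj b.
by rewrite -rmorphM !liftE /lift_mpoly rmorphM.
Qed.

(** The universal property of the quotient. It supplies the points, coordinate lines, gradings and
    branches used later. *)
Lemma edge_ring_lift : exists f : {rmorphism A -> C},
  (forall c, f (edge_const c) = k c) /\ forall v, f (edge_var v) = g v.
Proof.
pose f : {rmorphism A -> C} := HB.pack lift
  (GRing.isZmodMorphism.Build A C lift lift_zmod_morphism)
  (GRing.isMonoidMorphism.Build A C lift lift_monoid_morphism).
exists f; split=> [c|v] /=; rewrite ?edge_constE liftE /lift_mpoly ?mmapC //.
by rewrite mmapX mmap1U /= enum_rankK.
Qed.

End Lift.

Lemma eq_edge_morph (C : comNzRingType) (f g : {rmorphism A -> C}) :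
  (forall c, f (edge_const c) = g (edge_const c)) ->
  (forall v, f (edge_var v) = g (edge_var v)) -> f =1 g.
Proof.
move=> fgc fgv; apply: edge_ring_ind => // a b fa fb.
  by rewrite !rmorphD fa fb.
by rewrite !rmorphM fa fb.
Qed.

End EdgeRing.

Arguments edge_const {T} e K.

(** * Koszul cohomology *)

Section Koszul.
Variable A : comNzRingType.
Implicit Types (I : A -> Prop) (xs cs : seq A) (f g z w : bitseq -> A).
Implicit Types (a s t : A) (b : bitseq).

(** The Koszul differential. A bit sequence is the indicator of a set of positions in [xs], and its
    number of [true] bits is the degree; a cochain is a function of bit sequences. *)
Fixpoint koszul_d xs f b {struct xs} : A :=
  match xs, b with
  | x :: xs', true :: b' =>
      x * f (false :: b') - koszul_d xs' (fun c => f (true :: c)) b'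
  | x :: xs', false :: b' => koszul_d xs' (fun c => f (false :: c)) b'
  | _, _ => 0
  end.

(** Contraction with the vector [xs], in the role of the coefficients [cs]; it lowers the degree by
    one. *)
Fixpoint koszul_h xs f b {struct xs} : A :=
  match xs, b with
  | c :: cs, false :: b' =>
      c * f (true :: b') + koszul_h cs (fun b => f (false :: b)) b'
  | c :: cs, true :: b' => - koszul_h cs (fun b => f (true :: b)) b'
  | _, _ => 0
  end.

Lemma koszul_d_lin xs s t f g b :
  koszul_d xs (fun c => s * f c + t * g c) b
  = s * koszul_d xs f b + t * koszul_d xs g b.
Proof.
elim: xs f g b => [|x xs IH] f g [|[] b] /=; rewrite ?IH; ring.
Qed.

Lemma koszul_h_lin xs s t f g b :
  koszul_h xs (fun c => s * f c + t * g c) b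
  = s * koszul_h xs f b + t * koszul_h xs g b.
Proof.
elim: xs f g b => [|x xs IH] f g [|[] b] /=; rewrite ?IH; ring.
Qed.

Lemma koszul_dB xs t f g b :
  koszul_d xs (fun c => f c - t * g c) b = koszul_d xs f b - t * koszul_d xs g b.
Proof.
rewrite (_ : (fun c => f c - t * g c) = (fun c => 1 * f c + - t * g c)).
  by rewrite koszul_d_lin; ring.
by apply: funext => c; ring.
Qed.

Lemma koszul_dZB xs t f g b :
  koszul_d xs (fun c => t * f c - g c) b = t * koszul_d xs f b - koszul_d xs g b.
Proof.
rewrite (_ : (fun c => t * f c - g c) = (fun c => t * f c + -1 * g c)).
  by rewrite koszul_d_lin; ring.
by apply: funext => c; ring.
Qed.

Lemma koszul_d0 xs f b : count id b = 0%N -> koszul_d xs f b = 0.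
Proof. by elim: xs f b => [|x xs IH] f [|[] b] //=; rewrite add0n; apply: IH. Qed.

Lemma koszul_dd xs f b : koszul_d xs (koszul_d xs f) b = 0.
Proof.
elim: xs f b => [|x xs IH] f [|[] b] //=.
by rewrite koszul_dZB IH subr0 subrr.
Qed.

(** Contraction is a homotopy from multiplication by a combination of [xs] to 0, so the ideal
    spanned by [xs] annihilates Koszul cohomology. *)
Lemma koszul_homotopy xs cs f b : size cs = size xs -> size b = size xs ->
  koszul_d xs (koszul_h cs f) b + koszul_h cs (koszul_d xs f) b
  = (\sum_(p <- zip cs xs) p.1 * p.2) * f b.
Proof.
elim: xs cs f b => [|x xs IH] [|c cs] f [|[] b] //=; rewrite ?big_nil ?big_cons /=.
- by rewrite addr0 mul0r.
- move=> [sc] [sb].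
  rewrite (_ : (fun b' => x * _ - _) = (fun b' => x * f (false :: b')
     + -1 * koszul_d xs (fun c => f (true :: c)) b')); last first.
    by apply: funext => b'; ring.
  rewrite koszul_h_lin.
  rewrite (_ : (fun b' => - koszul_h _ _ _) =
     (fun b' => 0 * 0 + -1 * koszul_h cs (fun c => f (true :: c)) b')); last first.
    by apply: funext => b'; ring.
  rewrite koszul_d_lin mulrDl -(IH cs (fun c => f (true :: c))) //; ring.
move=> [sc] [sb].
rewrite (_ : (fun b' => c * _ + _) = (fun b' => c * f (true :: b')
     + 1 * koszul_h cs (fun c => f (false :: c)) b')); last first.
  by apply: funext => b'; ring.
by rewrite koszul_d_lin mulrDl -(IH cs (fun c => f (false :: c))) //; ring.
Qed.

Lemma koszul_d_in I xs f i : is_ideal I ->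
  (forall b, size b = size xs -> count id b = i -> I (f b)) ->
  forall b, size b = size xs -> count id b = i.+1 -> I (koszul_d xs f b).
Proof.
move=> II; have [I0 ID IM] := II.
elim: xs f i => [|x xs IH] f i fI [|[] b] //= [sb] cb; last first.
  by apply: (IH _ i) => // c sc cc; apply: fI => //=; rewrite sc.
apply: ideal_sub => //.
  apply: IM; apply: fI; first by rewrite /= sb.
  by move: cb; rewrite /= add0n add1n => -[].
case: i fI cb => [|i] fI [cb]; first by rewrite koszul_d0.
by apply: (IH _ i) => // c sc cc; apply: fI => /=; rewrite ?sc ?cc.
Qed.

Lemma koszul_h_in I xs f i : is_ideal I ->
  (forall b, size b = size xs -> count id b = i.+1 -> I (f b)) ->
  forall b, size b = size xs -> count id b = i -> I (koszul_h xs f b).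
Proof.
move=> II; have [I0 ID IM] := II.
elim: xs f i => [|x xs IH] f i fI [|[] b] //= [sb] cb.
  apply: ideal_opp => //; case: i fI cb => // i fI [cb].
  by apply: (IH _ i) => // c sc cc; apply: fI => /=; rewrite ?sc ?cc.
apply: ID; first by apply: IM; apply: fI => /=; rewrite ?sb -?cb.
by apply: (IH _ i) => // c sc cc; apply: fI => //=; rewrite sc.
Qed.

Lemma koszul_d1 xs f b : size b = size xs -> count id b = 1%N ->
  koszul_d xs f b = nth 0 xs (index true b) * f (nseq (size xs) false).
Proof.
elim: xs f b => [|x xs IH] f [|[] b] //= [sb] cb; last by rewrite IH.
case: cb => cb; rewrite koszul_d0 // subr0; congr (_ * f (_ :: _)).
apply: (@eq_from_nth _ false) => [|i ib]; first by rewrite size_nseq.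
rewrite nth_nseq if_same; apply/negbTE/negP => bi.
by have := cb; apply/eqP; rewrite -lt0n -has_count; apply/(has_nthP false); exists i.
Qed.

(** A cochain of degree 1 is a list [ys], and the entries of its differential are the 2 by 2 minors
    of [xs] and [ys]. *)
Lemma koszul_d2 I xs ys b : is_ideal I -> size ys = size xs ->
  (forall i j, (i < j < size xs)%N ->
     I (nth 0 xs i * nth 0 ys j - nth 0 xs j * nth 0 ys i)) ->
  size b = size xs -> count id b = 2%N ->
  I (koszul_d xs (fun c => nth 0 ys (index true c)) b).
Proof.
move=> II; elim: xs ys b => [|x xs IH] [|y ys] [|[] b] //= [sy] Ixy [sb] cb.
- have cb1 : count id b = 1%N by case: cb.
  rewrite koszul_d1 //; apply: (Ixy 0%N (index true b).+1) => /=.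
  by rewrite ltnS -sb index_mem -has_pred1 (eq_has (a2 := id)) ?has_count ?cb1 // => -[].
- by apply: IH => // i j ij; apply: (Ixy i.+1 j.+1).
Qed.

(** Vanishing of the Koszul cohomology of [A/I] in degrees below [d], written with representatives
    in [A] so that no quotient is formed. *)
Definition koszul_vanish xs I d : Prop := forall i, (i < d)%N -> forall z,
  (forall b, size b = size xs -> count id b = i.+1 -> I (koszul_d xs z b)) ->
  exists w, forall b, size b = size xs -> count id b = i ->
    I (z b - koszul_d xs w b).

Definition ideal_add I t : A -> Prop := fun a => exists c, I (a - t * c).

(* The next two lemmas are the two halves of the long exact sequence of Koszul
   cohomology attached to multiplication by [t] on [A/I]. *)
Lemma koszul_vanish_add xs I t d : is_ideal I -> (forall a, I (t * a) -> I a) ->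
  koszul_vanish xs I d.+1 -> koszul_vanish xs (ideal_add I t) d.
Proof.
move=> II tI van i ltid z dz.
have /choice[y yP] : forall b, exists c, size b = size xs -> count id b = i.+1 ->
    I (koszul_d xs z b - t * c).
  move=> b; case: (pselect (size b = size xs /\ count id b = i.+1)).
    by case=> sb cb; have [c cI] := dz b sb cb; exists c.
  by move=> nb; exists 0 => sb cb; case: nb.
(* Modulo [I] the differential of [z] is [t y]; since the differential squares to 0, cancelling [t]
   makes [y] a cocycle. It is the coboundary of some [w], and then [z - t w] is a cocycle modulo
   [I]. *)
have [w wP] : exists w, forall b, size b = size xs -> count id b = i.+1 ->
    I (y b - koszul_d xs w b).
  apply: van => // b sb cb; apply: tI.
  rewrite (_ : _ * _ = - koszul_d xs (fun c => koszul_d xs z c - t * y c) b).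
    by apply: ideal_opp => //; apply: (koszul_d_in (i := i.+1)).
  by rewrite koszul_dB koszul_dd; ring.
have [w' w'P] : exists w', forall b, size b = size xs -> count id b = i ->
    I ((z b - t * w b) - koszul_d xs w' b).
  apply: (van i (ltnW ltid) (fun b => z b - t * w b)) => b sb cb.
  rewrite koszul_dB; case: (II) => I0 ID IM.
  rewrite (_ : _ - _ = (koszul_d xs z b - t * y b) + t * (y b - koszul_d xs w b)).
    by apply: ID; [apply: yP | apply/IM/wP].
  by ring.
exists w' => b sb cb; exists (w b).
by rewrite addrAC; apply: w'P.
Qed.

Lemma koszul_vanish_lift xs I t d : is_ideal I -> (forall a, I (t * a) -> I a) ->
  in_span xs t -> koszul_vanish xs (ideal_add I t) d -> koszul_vanish xs I d.+1.
Proof.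
move=> II tI [c tE] van i ltid z dz; have [I0 ID IM] := II.
pose cs := [seq c j | j <- enum 'I_(size xs)].
have scs : size cs = size xs by rewrite size_map size_enum_ord.
have tz b : size b = size xs ->
    t * z b = koszul_d xs (koszul_h cs z) b + koszul_h cs (koszul_d xs z) b.
  move=> sb; rewrite koszul_homotopy // tE; congr (_ * _).
  rewrite (big_nth (0, 0)) size_zip scs minnn big_mkord; apply: eq_bigr => j _.
  rewrite nth_zip //= (nth_map j) ?size_enum_ord //; congr (c _ * _).
  by apply: val_inj; rewrite /= nth_enum_ord.
have hdz b : size b = size xs -> count id b = i ->
    I (koszul_h cs (koszul_d xs z) b).
  by rewrite -scs; apply: koszul_h_in => // b'; rewrite scs; apply: dz.
case: i ltid z dz tz hdz => [|i] ltid z dz tz hdz.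
  exists (fun=> 0) => b sb cb; rewrite koszul_d0 // subr0; apply: tI.
  by rewrite tz // koszul_d0 // add0r; apply: hdz.
(* By the homotopy formula the differential of [koszul_h cs z] is [t z] modulo [I], so
   [koszul_h cs z] is a cocycle modulo [I] and [t]. Writing it as the coboundary of [y] plus [t w]
   and applying the differential gives [t z = t (koszul_d xs w)] modulo [I]. *)
have [y yP] : exists y, forall b, size b = size xs -> count id b = i ->
    ideal_add I t (koszul_h cs z b - koszul_d xs y b).
  apply: (van i ltid) => b sb cb; exists (z b); rewrite tz //.
  by rewrite opprD addrA subrr add0r; apply/(ideal_opp II)/hdz.
have /choice[w wP] : forall b, exists c, size b = size xs -> count id b = i ->
    I (koszul_h cs z b - koszul_d xs y b - t * c).
  move=> b; case: (pselect (size b = size xs /\ count id b = i)).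
    by case=> sb cb; have [c' cI] := yP b sb cb; exists c'.
  by move=> nb; exists 0 => sb cb; case: nb.
exists w => b sb cb; apply: tI.
rewrite (_ : _ * _ = koszul_d xs (fun b => koszul_h cs z b - koszul_d xs y b - t * w b) b
   + koszul_h cs (koszul_d xs z) b).
  by apply: ID (hdz b sb cb); apply: (koszul_d_in (i := i)).
rewrite mulrBr tz // koszul_dB.
rewrite (_ : (fun b => _ - _) = (fun b => koszul_h cs z b - 1 * koszul_d xs y b)).
  by rewrite koszul_dB koszul_dd; ring.
by apply: funext => b'; rewrite mul1r.
Qed.
End Koszul.

(** * Regular sequences and Koszul cohomology *)

Section KoszulDepth.
Variable A : comNzRingType.
Implicit Types (s xs : seq A) (a t : A).

Lemma span_take_next s k : (k < size s)%N ->
  in_span (take k.+1 s) = ideal_add (in_span (take k s)) s`_k.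
Proof.
move=> ks; apply: funext => a; apply: propext.
by rewrite (take_nth 0) //; apply: span_rcons.
Qed.

(** Start modulo all of [s], where nothing is claimed, and remove its elements from the last to the
    first; each removal gains one degree of vanishing. *)
Lemma koszul_vanish_regular xs s : regular_seq s ->
  {in s, forall t, in_span xs t} -> koszul_vanish xs (in_span [::]) (size s).
Proof.
move=> [reg _] sxs.
suff van k : (k <= size s)%N ->
    koszul_vanish xs (in_span (take (size s - k) s)) k.
  by have := van (size s) (leqnn _); rewrite subnn take0.
elim: k => [|k IH] ks //; have lt : (size s - k.+1 < size s)%N by lia.
apply: (@koszul_vanish_lift _ _ _ s`_(size s - k.+1)).
- exact: span_ideal.
- exact: reg.
- by apply: sxs; apply: mem_nth.
rewrite -span_take_next //; have -> : (size s - k.+1).+1 = (size s - k)%N by lia.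
by apply: IH; lia.
Qed.

Lemma koszul_vanish_quotient xs s d : (forall i, (i < size s)%N -> forall a,
     in_span (take i s) (s`_i * a) -> in_span (take i s) a) ->
  koszul_vanish xs (in_span [::]) (size s + d) -> koszul_vanish xs (in_span s) d.
Proof.
move=> reg van0.
suff van k : (k <= size s)%N ->
    koszul_vanish xs (in_span (take k s)) (size s - k + d).
  by have := van (size s) (leqnn _); rewrite subnn take_size.
elim: k => [|k IH] ks; first by rewrite take0 subn0.
rewrite span_take_next //; apply: koszul_vanish_add.
- exact: span_ideal.
- exact: reg.
by have := IH (ltnW ks); congr koszul_vanish; lia.
Qed.

(** The minors say that [ys] is a cocycle of degree 1 modulo [I]; a coboundary of degree 1 is a
    multiple of [xs]. *)
Lemma koszul_vanish2 I xs ys : is_ideal I -> koszul_vanish xs I 2 ->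
  size ys = size xs ->
  (forall i j, (i < j < size xs)%N -> I (xs`_i * ys`_j - xs`_j * ys`_i)) ->
  exists a, forall i, (i < size xs)%N -> I (ys`_i - xs`_i * a).
Proof.
move=> II van sy Ixy.
have [|w wP] := van 1%N isT (fun b => ys`_(index true b)).
  by move=> b sb cb; apply: koszul_d2.
exists (w (nseq (size xs) false)) => i ix.
pose b := nseq i false ++ true :: nseq (size xs - i.+1) false.
have sb : size b = size xs by rewrite size_cat /= !size_nseq; lia.
have cb : count id b = 1%N by rewrite count_cat /= !count_nseq /=; lia.
have ib : index true b = i.
  by rewrite index_cat mem_nseq andbF /= size_nseq addn0.
by have := wP b sb cb; rewrite koszul_d1 // ib.
Qed.

End KoszulDepth.

(** * Kernels as prime and maximal ideals; chains of primes *)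

Section KernelIdeals.
Variable A : comNzRingType.

Lemma kernel_ideal (C : comNzRingType) (f : {rmorphism A -> C}) :
  idealr_closed (fun a => f a == 0).
Proof.
split=> [||a u v]; rewrite !unfold_in ?rmorph0 ?rmorph1 ?oner_eq0 //.
by rewrite rmorphD rmorphM => /eqP-> /eqP->; rewrite mulr0 addr0.
Qed.

Lemma kernel_prime (C : idomainType) (f : {rmorphism A -> C}) :
  prime_ideal (fun a => f a == 0).
Proof.
split; first exact: kernel_ideal.
by move=> a b; rewrite !unfold_in rmorphM mulf_eq0.
Qed.

Lemma kernel_maximal (Q : fieldType) (f : {rmorphism A -> Q}) :
  (forall q, exists a, f a = q) -> maximal_ideal (fun a => f a == 0).
Proof.
move=> surj; split; first exact: kernel_ideal.
move=> J Jc sub a aJ; rewrite unfold_in; apply/negP => /negP fa.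
have [c fc] := surj (f a)^-1; have [_ /negP J1 JM] := Jc.
case: J1; rewrite (_ : 1 = c * a + (1 - c * a)); last by ring.
apply: JM => //; apply: sub; rewrite unfold_in rmorphB rmorphM rmorph1 fc.
by rewrite mulVf // subrr.
Qed.

End KernelIdeals.

Lemma mpoly_morph (n : nat) (R : fieldType) (C : comNzRingType) (k : {rmorphism R -> C})
    (h : 'I_n -> C) : exists f : {rmorphism {mpoly R[n]} -> C},
  (forall c, f c%:MP = k c) /\ forall i, f 'X_i = h i.
Proof.
exists (mmap k h : {rmorphism {mpoly R[n]} -> C}).
by split=> [c|i] /=; rewrite ?mmapC // mmapX mmap1U.
Qed.

Section EdgeChains.
Variables (T : finType) (e : rel T) (K : fieldType).
Local Notation A := (edge_ring e K).
Local Notation c_ := (edge_const e K).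
Local Notation x_ := (edge_var e K).

(* The kernels of the maps specializing one by one the variables of a face of
   the independence complex, all other variables being sent to 0. *)
Lemma edge_prime_chain (Q : fieldType) (f : {rmorphism A -> Q}) (F : {set T}) :
  independent e F -> (forall v, v \notin F -> f (x_ v) = 0) ->
  (forall v, v \in F ->
     exists2 p : {poly K}, p != 0 & (map_poly (f \o c_) p).[f (x_ v)] = 0) ->
  exists P, prime_chain_in (fun a => f a == 0) #|F| P.
Proof.
move=> indF f0 falg.
pose y k v : {mpoly Q[#|T|]} := if (v \in F) && (k <= index v (enum F))%N
  then vertex_var Q v else (f (x_ v))%:MP.
have yM k u v : e u v -> y k u * y k v = 0.
  move=> euv; have : ~~ ((u \in F) && (v \in F)).
    apply/negP => /andP[uF vF].
    by move/forall_inP/(_ u uF)/forall_inP/(_ v vF): indF; rewrite euv.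
  rewrite negb_and /y => /orP[] nF; rewrite (negPf nF) /= (f0 _ nF).
    by rewrite mpolyC0 mul0r.
  by rewrite mpolyC0 mulr0.
have /choice[t tP] : forall k, exists t : {rmorphism A -> {mpoly Q[#|T|]}},
    (forall c, t (c_ c) = (f (c_ c))%:MP) /\ forall v, t (x_ v) = y k v.
  by move=> k; exact: (edge_ring_lift (@mpolyC _ Q \o f \o c_) (yM k)).
have tlast a : t #|F| a = (f a)%:MP.
  apply: (eq_edge_morph (f := t #|F|) (g := @mpolyC _ Q \o f)) => [c|v] /=.
    by rewrite (tP _).1.
  rewrite (tP _).2 /y; case: ifP => // /andP[vF].
  by rewrite leqNgt cardE index_mem mem_enum vF.
exists (fun k a => t k a == 0); split.
- by move=> k _; apply: kernel_prime.
- move=> k kF; have [v0 _] : exists v0, v0 \in F by apply/card_gt0P; lia.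
  pose v := nth v0 (enum F) k.
  have iv : index v (enum F) = k by rewrite index_uniq ?enum_uniq // -cardE.
  have vF : v \in F by rewrite -mem_enum mem_nth // -cardE.
  split.
    pose mC : {rmorphism Q -> {mpoly Q[#|T|]}} := @mpolyC #|T| Q.
    have [s [sC sX]] := mpoly_morph mC (fun i : 'I_#|T| => y k.+1 (enum_val i)).
    have sy w : s (y k w) = y k.+1 w.
      rewrite {1}/y; case: ifP => [_|nw].
        by rewrite sX enum_rankK.
      rewrite sC /y; case: ifP => // /andP[wF kw]; move: nw.
      by rewrite wF (ltnW kw).
    have st : s \o t k =1 t k.+1.
      apply: (eq_edge_morph (f := s \o t k)) => [c|w] /=.
        by rewrite !(tP _).1 sC.
      by rewrite !(tP _).2 sy.
    move=> a; rewrite !unfold_in => /eqP ta.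
    by rewrite -st /= ta rmorph0.
  (* The inclusion is strict because [p] evaluated at [x_ v] dies once [x_ v] is specialized, but
     not while it is still a variable. The morphism [q] below sends all variables to ['X] and
     reduces the latter claim to one variable. *)
  have [p p0 pv] := falg v vF.
  have tk l : t l (map_poly c_ p).[x_ v]
      = (map_poly (@mpolyC #|T| Q \o (f \o c_)) p).[y l v].
    rewrite -horner_map /= -map_poly_comp (tP _).2; congr (_.[_]).
    by apply: eq_map_poly => c /=; rewrite (tP _).1.
  move/(_ (map_poly c_ p).[x_ v]); rewrite !unfold_in !tk.
  rewrite {1}/y iv ltnn andbF map_poly_comp horner_map /= pv rmorph0 eqxx.
  move/(_ isT) => /eqP.
  have [q [qC qX]] := mpoly_morph (@polyC Q) (fun _ : 'I_#|T| => 'X).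
  rewrite /y vF iv leqnn /= => /(congr1 q).
  rewrite -horner_map /= qX -map_poly_comp.
  rewrite (eq_map_poly (f := q \o _) (g := polyC)) => [|c /=]; last by rewrite qC.
  rewrite rmorph0.
  rewrite -[_.[_]]/(_ \Po 'X) comp_polyXr => /eqP.
  by rewrite map_poly_eq0 (negPf p0).
by move=> a; rewrite !unfold_in tlast mpolyC_eq0.
Qed.

End EdgeChains.

(** * Obstruction to the Cohen-Macaulay property; exchange *)

Section CohenMacaulayObstruction.
Variables (T : finType) (e : rel T) (K : fieldType).
Hypotheses (e_sym : ssrbool.symmetric e) (e_irr : irreflexive e).
Local Notation A := (edge_ring e K).
Local Notation c_ := (edge_const e K).
Local Notation x_ := (edge_var e K).

Lemma independentP (F : {set T}) :
  reflect {in F &, forall u v, ~~ e u v} (independent e F).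
Proof.
apply: (iffP forall_inP) => [H u v uF vF|H u uF].
  exact: (forall_inP (H u uF)).
by apply/forall_inP => v vF; apply: H.
Qed.

(** The ring is graded by the degree in [x_ v], and the ideal [J] of the earlier elements is
    generated in degree 0. If [(x_ v - 1) * a] lies in [J], comparing components from degree 0
    upwards puts each component of [a] in [J]. *)
Lemma edge_var_sub1_regular (G : {set T}) i (s := [seq x_ g - 1 | g <- enum G]) :
  (i < size s)%N -> forall a, in_span (take i s) (s`_i * a) ->
  in_span (take i s) a.
Proof.
rewrite size_map -cardE => iG a; set J := in_span _.
have [v0 _] : exists v0, v0 \in G by apply/card_gt0P; lia.
pose v := nth v0 (enum G) i.
have sv : s`_i = x_ v - 1 by rewrite (nth_map v0) // -cardE.
have [J0 JD JM] : is_ideal J by apply: span_ideal.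
(* The resulting [f] encodes the grading: the coefficients of [f b] are the components of [b], and
   evaluation at 1 recovers [b]. *)
pose y u : {poly A} := if u == v then (x_ v)%:P * 'X else (x_ u)%:P.
have [u w euw|f [fc fx]] := edge_ring_lift (e := e) (@polyC A \o c_) (g := y).
  have {euw} := edge_var_mul K euw.
  rewrite /y; case: eqP => [->|_]; case: eqP => [->|_] uw0.
  - by rewrite mulrACA -polyCM uw0 mul0r.
  - by rewrite mulrAC -polyCM uw0 mul0r.
  - by rewrite mulrA -polyCM uw0 mul0r.
  - by rewrite -polyCM uw0.
have f1 b : (f b).[1] = b.
  apply: (eq_edge_morph (f := horner_eval 1 \o f) (g := idfun)) => [c|u] /=.
    by rewrite fc /horner_eval /= hornerC.
  rewrite fx /horner_eval /y; case: eqP => [->|_]; rewrite !hornerE //.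
have Jf b : J b -> forall k, J (f b)`_k.
  apply: (@span_sub _ (fun b => forall k, J (f b)`_k)).
    split=> [k|b1 b2 J1 J2 k|b1 b2 J2 k].
    - by rewrite rmorph0 coef0.
    - by rewrite rmorphD coefD; apply: JD.
    - by rewrite rmorphM coefM; apply: ideal_sum => // j _; apply: JM.
  move=> g gs k.
  have : g \in [seq x_ g - 1 | g <- take i (enum G)] by rewrite map_take.
  case/mapP => u uG gE.
  have uv : u != v.
    apply/eqP => uv; have := take_uniq i.+1 (enum_uniq G).
    rewrite (take_nth v0) -?cardE // -/v rcons_uniq -uv uG //.
  rewrite gE rmorphB rmorph1 fx /y (negPf uv) -polyC1 -polyCB coefC.
  by case: eqP => // _; rewrite -gE; apply: mem_span.
rewrite sv => /Jf; rewrite rmorphM rmorphB rmorph1 fx /y eqxx => Jk.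
have fa k : J (f a)`_k.
  elim: k => [|k IH]; have := Jk _.
    move/(_ 0%N); rewrite mulrBl mul1r -mulrA coefB coefCM coefXM /= mulr0 sub0r.
    by move/(ideal_opp (span_ideal _)); rewrite opprK.
  move/(_ k.+1); rewrite mulrBl mul1r -mulrA coefB coefCM coefXM /= => Jk1.
  rewrite (_ : _`_k.+1 = x_ v * (f a)`_k - (x_ v * (f a)`_k - (f a)`_k.+1)).
    by apply: (ideal_sub (span_ideal _)) => //; apply: JM.
  by ring.
rewrite -[a]f1 horner_coef; apply: ideal_sum => // j _.
by rewrite expr1n mulr1.
Qed.

Section Obstruction.
Variables (F G : {set T}) (b : T).
Hypotheses (indF : independent e F) (subGF : G \subset F).
Hypotheses (b_F : b \notin F) (b_G : {in G, forall g, ~~ e b g}).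
Hypothesis joined : forall v, v \notin F -> {in G, forall g, ~~ e v g} ->
  {in F :\: G, forall f, e v f}.

(** The set [w |: G] is independent, so no edge has both ends in the support of [y]. *)
Let point_mul (C : comNzRingType) (y : T -> C) w :
  {in G, forall g, ~~ e w g} ->
  (forall v, v \notin w |: G -> y v = 0) ->
  forall u v, e u v -> y u * y v = 0.
Proof.
move=> wG y0 u v euv; have := independentP _ indF.
have sub := subsetP subGF.
case: (boolP (u \in w |: G)) => [uG|/y0->]; last by rewrite mul0r.
case: (boolP (v \in w |: G)) => [vG|/y0->]; last by rewrite mulr0.
move: uG vG euv => /setU1P[->|uG] /setU1P[->|vG] euv ind.
- by rewrite e_irr in euv.
- by have := wG v vG; rewrite euv.
- by have := wG u uG; rewrite e_sym euv.
- by have := ind _ _ (sub _ uG) (sub _ vG); rewrite euv.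
Qed.

Let F_G w : w \in F -> {in G, forall g, ~~ e w g}.
Proof.
by move=> wF g gG; apply: (independentP _ indF) => //; apply: (subsetP subGF).
Qed.

(** By [joined], no face of the link of [G] connects [F :\: G] to the rest of that link, where [b]
    lies. If [F :\: G] had two elements, enough depth would remain after dividing by the [x_ g - 1]
    to kill the first Koszul cohomology; but the cocycle equal to the coordinates on [F :\: G] and
    to 0 elsewhere is not a coboundary. *)
Lemma cohen_macaulay_link_connected :
  cohen_macaulay_graph e K -> (#|F :\: G| <= 1)%N.
Proof.
move=> [_ cm]; rewrite leqNgt; apply/negP => FG2.
pose y v : K := (v \in G)%:R.
have [f [fc fx]] : exists f : {rmorphism A -> K},
    (forall c, f (c_ c) = c) /\ forall v, f (x_ v) = y v.
  apply: (edge_ring_lift (e := e) idfun); apply: (point_mul (w := b)) => // v.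
  by rewrite !inE negb_or /y => /andP[_ /negPf->].
have f_surj q : exists a, f a = q by exists (c_ q).
have [d [[s [reg sM] sd] _] [_ codim]] := cm _ (kernel_maximal f_surj).
(* Specializing the variables of [F] one by one gives a chain of primes of length [#|F|] below the
   point; its codimension is [d], which is also its depth. *)
have leFd : (#|F| <= d)%N.
  have [v vF|v vF|P /codim//] := edge_prime_chain (f := f) indF.
    rewrite fx /y; case: (boolP (v \in G)) => // /(subsetP subGF).
    by rewrite (negPf vF).
  exists ('X - (y v)%:P); first by rewrite polyXsubC_eq0.
  rewrite (eq_map_poly (g := idfun)) => [|c]; last exact: fc.
  by rewrite map_poly_id // fx !hornerE subrr.
pose x' v := x_ v - (v \in G)%:R.
have [r rT] : exists r : seq T, forall v, v \in r.
  by exists (enum T) => v; rewrite mem_enum.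
pose xs := [seq x' v | v <- r].
have genM a : in_span xs (a - c_ (f a)).
  have [I0 ID IM] := span_ideal xs.
  elim/edge_ring_ind: a => [c|v|a a' Ia Ia'|a a' Ia Ia'].
  - by rewrite fc subrr.
  - apply: mem_span; rewrite fx /y rmorph_nat.
    by apply/mapP; exists v.
  - rewrite !rmorphD (_ : _ - _ = (a - c_ (f a)) + (a' - c_ (f a'))).
      exact: ID.
    by ring.
  - rewrite !rmorphM.
    rewrite (_ : _ - _ = a * (a' - c_ (f a')) + c_ (f a') * (a - c_ (f a))).
      by apply: ID; apply: IM.
    by ring.
pose s' := [seq x_ g - 1 | g <- enum G].
have van : koszul_vanish xs (in_span s') 2.
  apply: koszul_vanish_quotient; first exact: edge_var_sub1_regular.
  have vand : koszul_vanish xs (in_span [::]) d.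
    rewrite -sd; apply: koszul_vanish_regular => // t /sM.
    by rewrite unfold_in => /eqP ft; rewrite -[t]subr0 -(rmorph0 c_) -ft.
  move=> i id; apply: vand; apply: leq_trans id _.
  rewrite size_map -cardE; apply: leq_trans leFd.
  by rewrite -(cardsID G F) (setIidPr subGF); lia.
have II := span_ideal s'; have [I0 ID IM] := II.
set I := in_span s' in van II I0 ID IM.
(* This is the cocycle: a coordinate on [F :\: G] times one outside it lies in [I], so all the
   minors with [x'] lie in [I]. *)
pose z v := if v \in F :\: G then x_ v else 0.
have x'G v : v \in G -> I (x' v).
  move=> vG; apply: mem_span; rewrite /x' vG.
  by apply/mapP; exists v; rewrite ?mem_enum.
have Ixz u v : u \notin F :\: G -> v \in F :\: G -> I (x' u * z v).
  move=> uW vW; rewrite /z vW; case: (boolP (u \in G)) => uG.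
    by apply: ideal_mulr => //; apply: x'G.
  have uF : u \notin F by move: uW; rewrite inE uG.
  rewrite /x' (negPf uG) subr0.
  case: (pselect {in G, forall g, ~~ e u g}) => [ug|].
    by rewrite edge_var_mul //; apply: joined.
  move/existsNP => [g /not_implyP[gG /negP]]; rewrite negbK => eug.
  apply: ideal_mulr => //.
  rewrite (_ : x_ u = - x_ u * x' g + x_ u * x_ g).
    by rewrite edge_var_mul // addr0; apply: IM; apply: x'G.
  by rewrite /x' gG mulr1n; ring.
have [|i j|a aP] := koszul_vanish2 (ys := [seq z v | v <- r]) II van.
- by rewrite !size_map.
- rewrite size_map => /andP[ij jT]; have iT := ltn_trans ij jT.
  rewrite /xs !(nth_map b) //; set u := nth b r i; set v := nth b r j.
  case: (boolP (u \in F :\: G)) => uW; case: (boolP (v \in F :\: G)) => vW.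
  + rewrite /z uW vW /x'; move: uW vW; rewrite !inE.
    case/andP => /negPf-> _ /andP[/negPf-> _]; rewrite !subr0 [X in X - _]mulrC.
    by rewrite subrr.
  + by rewrite {1}/z (negPf vW) mulr0 sub0r; apply: (ideal_opp II); apply: Ixz.
  + by rewrite {2}/z (negPf uW) mulr0 subr0; apply: Ixz.
  + by rewrite /z (negPf uW) (negPf vW) !mulr0 subrr.
have {}aP v : I (z v - x' v * a).
  have := aP (index v r); rewrite size_map index_mem rT => /(_ isT).
  by rewrite /xs !(nth_map b) ?index_mem // nth_index.
(* Near the point [f] the coordinate line of [w] lies in the variety. *)
have line w : w \notin G -> {in G, forall g, ~~ e w g} ->
    exists2 t : {rmorphism A -> {poly K}}, t (x_ w) = 'X &
      (forall a, I a -> t a = 0) /\ forall a, (t a).[0] = f a.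
  move=> wG ewG; pose yw v : {poly K} := if v == w then 'X else (y v)%:P.
  have [|t [tc tx]] := edge_ring_lift (e := e) (@polyC K) (g := yw).
    apply: (point_mul (w := w)) => // v.
    by rewrite !inE negb_or /yw /y => /andP[/negPf-> /negPf->].
  exists t; first by rewrite tx /yw eqxx.
  split.
    move=> a'; apply: (@span_sub _ (fun a => t a = 0)).
      split=> [|a1 a2 t1 t2|a1 a2 t2]; first exact: rmorph0.
      by rewrite rmorphD t1 t2 addr0.
      by rewrite rmorphM t2 mulr0.
    move=> _ /mapP[g + ->]; rewrite mem_enum => gG.
    rewrite rmorphB rmorph1 tx /yw /y gG.
    by case: eqP wG => [<-|_ _]; rewrite ?gG // subrr.
  move=> a'.
  apply: (eq_edge_morph (f := horner_eval 0 \o t) (g := f)) => [c|v] /=.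
    by rewrite tc fc /horner_eval hornerC.
  rewrite tx fx /horner_eval /yw; case: eqP => [->|_].
    by rewrite hornerX /y (negPf wG).
  by rewrite hornerC.
(* Modulo [I], [z] is [a] times the coordinates. On the line of a vertex of [F :\: G] this reads
   ['X = 'X * t a] and forces the value 1 of [a] at the point; on the line of [b] it reads
   [0 = 'X * t a] and forces the value 0. *)
have fa1 : f a = 1.
  have [w wW] : exists w, w \in F :\: G by apply/card_gt0P; lia.
  have := wW; rewrite inE => /andP[wG wF].
  have [t tw [tI tf]] := line w wG (F_G wF).
  have := tI _ (aP w); rewrite /z wW /x' (negPf wG) subr0 rmorphB rmorphM tw.
  rewrite -{1}['X]mulr1 -mulrBr => /eqP; rewrite mulf_eq0 polyX_eq0 subr_eq0.
  by rewrite -tf => /= /eqP<-; rewrite hornerC.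
have bG : b \notin G by apply: contra b_F; apply: (subsetP subGF).
have [t tb [tI tf]] := line b bG b_G.
have := tI _ (aP b); rewrite /z inE bG (negPf b_F) /x' (negPf bG) subr0 sub0r.
rewrite rmorphN rmorphM tb => /eqP; rewrite oppr_eq0 mulf_eq0 polyX_eq0 /=.
by move=> /eqP ta; move: fa1; rewrite -tf ta horner0 => /esym/eqP; rewrite oner_eq0.
Qed.

End Obstruction.

End CohenMacaulayObstruction.

(** * The exchange property from depth and from shellings *)

Section Exchange.
Variables (T : finType) (e : rel T).
Hypotheses (e_sym : ssrbool.symmetric e) (e_irr : irreflexive e).

(** The guard [F != setT] sets aside the edgeless graph, where no vertex is left for [b]. *)
Definition exchange_property : Prop := forall F : {set T},
  maxset (independent e) F -> F != setT ->
  exists a b, [/\ a \in F, b \notin F & {in F, forall f, f != a -> ~~ e b f}].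

Lemma max_independent_neighbor (F : {set T}) b :
  maxset (independent e) F -> b \notin F -> exists2 f, f \in F & e b f.
Proof.
move=> /maxsetP[/independentP indF maxF] bF.
case: (pselect (exists2 f, f \in F & e b f)) => // nex; case/negP: bF.
rewrite -(maxF (b |: F)) ?setU11 ?subsetU1 //.
have nb f : f \in F -> ~~ e b f by move=> fF; apply/negP => ebf; case: nex; exists f.
apply/independentP => u v /setU1P[->|uF] /setU1P[->|vF].
- by rewrite e_irr.
- exact: nb.
- by rewrite e_sym nb.
- exact: indF.
Qed.

Lemma cohen_macaulay_exchange (K : fieldType) :
  cohen_macaulay_graph e K -> exchange_property.
Proof.
move=> cm F Fmax Fn.
have [b0 b0F] : exists b, b \notin F.
  by move: Fn; rewrite -subTset => /subsetPn[b _ bF]; exists b.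
pose N v := [set f in F | e v f].
have [b bF bmin] := @arg_minnP _ b0 [pred b | b \notin F] (fun b => #|N b|) b0F.
have indF : independent e F by case/maxsetP: Fmax.
have subG : F :\: N b \subset F by apply: subsetDl.
have FG : F :\: (F :\: N b) = N b.
  by rewrite setDDr setDv set0U; apply/setIidPr/subsetP => f; rewrite inE => /andP[].
have := cohen_macaulay_link_connected e_sym e_irr indF subG bF _ _ cm.
rewrite FG => le1.
have {}le1 : (#|N b| <= 1)%N.
  apply: le1 => [g|v vF vG f fb].
    by rewrite !inE => /andP[+ gF]; rewrite gF.
  (* Minimality of [N b] yields the hypothesis [joined]: a vertex whose neighbours in [F] all lie in
     [N b] is adjacent to all of [N b]. *)
  have sub : N v \subset N b.
    apply/subsetP => g; rewrite inE => /andP[gF evg]; apply/negPn/negP => gN.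
    by have := vG g; rewrite evg inE gN gF => /(_ isT).
  have /eqP NE : N v == N b by rewrite eqEcard sub bmin.
  by move: fb; rewrite -NE inE => /andP[].
have [a aF eba] := max_independent_neighbor Fmax bF.
exists a, b; split=> // f fF; apply: contraNN => ebf.
have aN : a \in N b by rewrite inE aF.
have fN : f \in N b by rewrite inE fF.
by move/card_le1_eqP: le1 => /(_ _ _ fN aN)->.
Qed.

Lemma face_dim_pred (H F : {set T}) :
  face_dim H = face_dim F - 1 <-> #|F| = #|H|.+1.
Proof. by rewrite /face_dim; split; lia. Qed.

(** For a facet [F] after the first, a facet [H] of the intersection with the earlier ones misses a
    single vertex [a] of [F] and lies in another facet [X]. A vertex of [X] outside [F] is
    nonadjacent to [H], so it serves as [b]. The first facet is compared with the second,
    well-coveredness making their sizes equal. *)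
Lemma shellable_exchange :
  well_covered e -> shellable_graph e -> exchange_property.
Proof.
move=> wc [s [us sP sh]] F Fmax Fn.
have facetE X : facet (Ind e) X = maxset (independent e) X.
  by apply: maxset_eq => Y; rewrite /= inE.
have [b bF] : exists b, b \notin F.
  by move: Fn; rewrite -subTset => /subsetPn[b _ bF]; exists b.
have [F' F'max bF'] : exists2 F' : {set T}, maxset (independent e) F' & b \in F'.
  have [|F' F'max sub] := @maxset_exists _ (independent e) [set b].
    by apply/independentP => u v /set1P-> /set1P->; rewrite e_irr.
  by exists F' => //; rewrite -sub1set.
suff [H [X [HF HX Xmax XF cH]]] : exists H X : {set T}, [/\ H \subset F, H \subset X,
    maxset (independent e) X, X != F & #|F| = #|H|.+1].
  have [/independentP indX maxX] := maxsetP Xmax.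
  have [indF maxF] := maxsetP Fmax.
  have [c cX cF] : exists2 c, c \in X & c \notin F.
    apply/subsetPn; apply: contra XF => XF.
    by rewrite (maxX F).
  have [a aF aH] : exists2 a, a \in F & a \notin H.
    by apply/subsetPn; apply/negP => /subset_leq_card; rewrite cH ltnn.
  have HE : H = F :\ a.
    apply/eqP; rewrite eqEcard subsetD1 HF aH /=.
    by move: cH; rewrite (cardsD1 a) aF add1n => -[->].
  exists a, c; split=> // f fF fa; apply: indX => //.
  by apply: (subsetP HX); rewrite HE !inE fa.
have Fs : F \in s by rewrite sP facetE.
have F's : F' \in s by rewrite sP facetE.
have FF' : F != F' by apply: contraNneq bF => ->.
have iF : (index F s < size s)%N by rewrite index_mem.
have smax i : (i < size s)%N -> maxset (independent e) (nth set0 s i).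
  by move=> i_s; rewrite -facetE -sP mem_nth.
(* A facet of the intersection of [F_i] with the earlier facets. *)
have shP i : (0 < i < size s)%N -> exists (H : {set T}) j, [/\ (j < i)%N,
    H \subset nth set0 s i, H \subset nth set0 s j & #|nth set0 s i| = #|H|.+1].
  move=> i_s; have := sh i i_s; cbv zeta; set D := _ :&: _ => pureD.
  have /andP[i0 is_] := i_s.
  have [|H Hmax _] := @maxset_exists _ [pred X | X \in D] set0.
    rewrite !inE /= sub0set andbT; apply/hasP; exists (nth set0 s 0).
      by rewrite -(nth_take (n0 := i)) // mem_nth // size_take is_.
    exact: sub0set.
  have := pureD H Hmax; have [HD _] := maxsetP Hmax; move: HD.
  rewrite !inE /= orbF => /andP[/hasP[X /(nthP set0)[j]]].
  rewrite size_take is_ => ji; rewrite nth_take // => <- HX Hi cH.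
  by exists H, j; split=> //; apply/face_dim_pred.
case: (posnP (index F s)) => [i0|i0]; last first.
  have [|H [j [ji HF HX cH]]] := shP (index F s); first by rewrite i0.
  rewrite nth_index // in HF cH.
  have js : (j < size s)%N by apply: ltn_trans ji iF.
  exists H, (nth set0 s j); split=> //; first exact: smax.
  by apply: contraTneq ji => jF; rewrite -leqNgt -jF index_uniq.
have s2 : (1 < size s)%N.
  rewrite ltnNge; apply: contra FF' => s1.
  have: (index F' s < size s)%N by rewrite index_mem.
  move/leq_trans/(_ s1); rewrite ltnS leqn0 => /eqP i'0.
  by rewrite -(nth_index set0 F's) -{1}(nth_index set0 Fs) i0 i'0.
have [|H [j [j1 HX HF cH]]] := shP 1%N; first by rewrite s2.
have j0 : j = index F s by apply/eqP; rewrite i0 -leqn0.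
rewrite j0 nth_index // in HF.
exists H, (nth set0 s 1); split=> //; first exact: smax.
  by rewrite -(nth_index set0 Fs) i0 nth_uniq // -i0.
by rewrite -cH; apply: wc => //; apply: smax.
Qed.

End Exchange.

(** * Finite rings with the exchange property *)

Section FiniteRings.
Variable R : finUnitRingType.
Implicit Types (x y a b l r u : R) (L : {set R}).

(** Left multiplication by [y] is injective, hence bijective by finiteness, so [y] also has a right
    inverse, which must be [x]. *)
Lemma finring_unit x y : x * y = 1 -> x \is a GRing.unit.
Proof.
move=> xy; have inj : injective ( *%R y).
  by move=> a b /(congr1 ( *%R x)); rewrite !mulrA xy !mul1r.
have yz := f_invF inj 1; set z := invF _ _ in yz.
apply/unitrP; exists y; split=> //.
by rewrite -[x]mulr1 -yz [x * _]mulrA xy mul1r.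
Qed.

Lemma nilpotent_1B_unit x n : x ^+ n = 0 -> 1 - x \is a GRing.unit.
Proof.
move=> xn; apply: (@finring_unit _ (\sum_(i < n) x ^+ i)).
have := subrX1 x n; rewrite xn sub0r => /(congr1 -%R).
by rewrite opprK -mulNr opprB => <-.
Qed.

Lemma idempotent_power x : exists2 n, (0 < n)%N & x ^+ n * x ^+ n = x ^+ n.
Proof.
have [i [p [p0 ip]]] : exists i p, (0 < p)%N /\ x ^+ (i + p) = x ^+ i.
  pose f (i : 'I_#|R|.+1) := x ^+ i.
  have /injectivePn[i [j ij fij]] : ~~ injectiveb f.
    by apply/negP => /injectiveP/leq_card; rewrite card_ord ltnn.
  wlog lt : i j ij fij / (i < j)%N.
    move=> W; case: (ltngtP i j) => [lt|lt|/val_inj ii]; first exact: (W i j).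
      by apply: (W j i) => //; rewrite eq_sym.
    by rewrite ii eqxx in ij.
  exists i, (j - i)%N; rewrite subn_gt0 lt subnKC; last exact: ltnW.
  by split.
have per k t : x ^+ (i + t + k * p) = x ^+ (i + t).
  elim: k => [|k IH]; first by rewrite addn0.
  rewrite (_ : (_ + _ = (i + p) + (t + k * p))%N); last by rewrite mulSn; lia.
  by rewrite exprD ip -exprD addnA.
have ge : (i <= i.+1 * p)%N by rewrite (leq_trans (leqnSn i)) // leq_pmulr.
(* A multiple of the period [p] that is at least the preperiod [i]; the successor keeps it positive
   when [i] is 0. *)
exists (i.+1 * p)%N; first by rewrite muln_gt0.
by rewrite -exprD -{1}(subnKC ge) per subnKC.
Qed.

Definition left_ideal L : Prop :=
  [/\ 0 \in L, {in L &, forall a b, a - b \in L}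
    & forall r, {in L, forall a, r * a \in L}].

Definition principal_left x : {set R} := [set r * x | r : R].

Lemma principal_left_ideal x : left_ideal (principal_left x).
Proof.
split.
- by apply/imsetP; exists 0; rewrite ?mul0r.
- move=> _ _ /imsetP[a _ ->] /imsetP[b _ ->].
  by apply/imsetP; exists (a - b); rewrite ?mulrBl.
- move=> r _ /imsetP[a _ ->].
  by apply/imsetP; exists (r * a); rewrite ?mulrA.
Qed.

Lemma mem_principal_left r x : r * x \in principal_left x.
Proof. by apply/imsetP; exists r. Qed.

Lemma left_idealD L a b : left_ideal L -> a \in L -> b \in L -> a + b \in L.
Proof.
case=> L0 LB _ aL bL; rewrite -[b]opprK; apply: (LB) => //.
by rewrite -sub0r; apply: LB.
Qed.

Definition trivial_1B (L : {set R}) : Prop :=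
  {in L, forall l, 1 - l \is a GRing.unit -> l = 0}.

(** Let [e] be an idempotent power of [l]. The element [l - e * l] is nilpotent, so [1] minus it is
    a unit and [l = e * l]. Then [l] is invertible in the corner ring of [e], which makes
    [1 - (e - l)] a unit, and [e = l]. *)
Lemma trivial_1B_idempotent L l : left_ideal L -> trivial_1B L ->
  l \in L -> l * l = l.
Proof.
move=> [L0 LB LM] tL lL; have [[//|n] _ en] := idempotent_power l.
set e := l ^+ n.+1 in en.
have eL : e \in L by rewrite /e exprSr; apply: LM.
have el : e * l = l * e by rewrite /e -exprS -exprSr.
have le : l = e * l.
  apply/eqP; rewrite -subr_eq0; apply/eqP/tL; first by apply: LB => //; apply: LM.
  apply: (@nilpotent_1B_unit _ n.+1).
  rewrite -{1}[l]mul1r -mulrBl exprMn_comm; last first.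
    by rewrite /GRing.comm mulrBl mulrBr mul1r mulr1 el.
  by rewrite -/e exprSr -mulrA mulrBl mul1r en subrr mulr0.
have lee : l * e = l by rewrite -el -le.
suff /eqP : e - l = 0 by rewrite subr_eq0 => /eqP<-.
apply: tL; first exact: LB.
apply: (@finring_unit _ ((1 - e) + e * l ^+ n)).
rewrite opprB addrA -[1 + l - e]addrAC mulrDl !mulrDr.
rewrite [l * (e * _)]mulrA lee -exprS -/e.
rewrite [(1 - e) * (e * _)]mulrA [(1 - e) * e]mulrBl mul1r en subrr mul0r.
rewrite !mulrN !mulr1 lee subrr [(1 - e) * e]mulrBl mul1r en subrr subr0 addr0.
by rewrite add0r subrK.
Qed.

Section Boolean.
Variable L : {set R}.
Hypotheses (Li : left_ideal L) (Lb : {in L, forall l, l * l = l}).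

Lemma boolean_add_self l : l \in L -> l + l = 0.
Proof.
move=> lL; have := Lb (left_idealD Li lL lL).
rewrite mulrDl !mulrDr Lb // => /(congr1 (fun z => z - (l + l))).
by rewrite addrK subrr.
Qed.

Lemma boolean_comm : {in L &, forall a b, a * b = b * a}.
Proof.
move=> a b aL bL; have [_ _ LM] := Li.
have := Lb (left_idealD Li aL bL).
rewrite mulrDl !mulrDr !Lb // [b * a + b]addrC addrACA -[RHS]addr0 => /addrI.
move/eqP; rewrite addr_eq0 => /eqP->; apply/esym/eqP.
by rewrite -addr_eq0 boolean_add_self // LM.
Qed.

(** Take [e] fixing as many elements as possible. If it did not fix [l], the Boolean join
    [e + (l - l * e)] would fix these elements and [l] as well. *)
Lemma boolean_left_identity : exists2 e, e \in L & {in L, forall l, l * e = l}.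
Proof.
have [L0 LB LM] := Li; pose S e := [set l in L | l * e == l].
have [e eL emax] := @arg_maxnP _ 0 (mem L) (fun e => #|S e|) L0.
exists e => // l lL; apply/eqP/negPn/negP => le.
pose e' := e + (l - l * e).
have lle : l - l * e \in L by rewrite LB // LM.
have e'L : e' \in L by apply: left_idealD.
have : (#|S e'| <= #|S e|)%N := emax _ e'L; rewrite leqNgt => /negP[]; apply: proper_card.
apply/properP; split.
  apply/subsetP => k; rewrite !inE => /andP[kL /eqP ke]; rewrite kL /e' /=.
  by rewrite mulrDr ke mulrBr mulrA (boolean_comm kL lL) -mulrA ke subrr addr0.
exists l; last by rewrite inE negb_and le orbT.
by rewrite inE lL /e' mulrDr mulrBr mulrA !Lb // addrC subrK eqxx.
Qed.

End Boolean.

Definition unitary_principle : Prop := forall L, left_ideal L ->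
  {in L, forall l, l \isn't a GRing.unit} ->
  exists2 u, u \is a GRing.unit & {in L, forall l, 1 - l * u \is a GRing.unit -> l = 0}.

Lemma left_ideal_mulr L u : left_ideal L -> left_ideal [set l * u | l in L].
Proof.
case=> L0 LB LM; split.
- by apply/imsetP; exists 0; rewrite ?mul0r.
- move=> _ _ /imsetP[a aL ->] /imsetP[b bL ->].
  by apply/imsetP; exists (a - b); rewrite ?mulrBl ?LB.
- move=> r _ /imsetP[a aL ->].
  by apply/imsetP; exists (r * a); rewrite ?mulrA ?LM.
Qed.

Lemma principle_idempotent L : unitary_principle -> left_ideal L ->
  {in L, forall l, l \isn't a GRing.unit} ->
  exists2 u, u \is a GRing.unit & {in L, forall l, l * u * (l * u) = l * u}.
Proof.
move=> UP Li Ln; have [u uu tu] := UP L Li Ln; exists u => // l lL.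
apply: (@trivial_1B_idempotent [set l * u | l in L]).
- exact: left_ideal_mulr.
- by move=> _ /imsetP[a aL ->] /tu->; rewrite ?mul0r.
- by apply/imsetP; exists l.
Qed.

(** The left ideal of [x], moved by a unit, becomes a left ideal [L] of idempotents with an identity
    [e != 0]. Once [e] is shown central, the ring splits along [e] and [1 - e]. Multiples of [e] lie
    in [L]; multiples of [1 - e] are nonunits, and the principle applied to them makes them
    idempotent too. *)
Lemma unitary_principle_boolean x : unitary_principle ->
  x != 0 -> x \isn't a GRing.unit -> forall y, y * y = y.
Proof.
move=> UP x0 xn.
have xu : {in principal_left x, forall l, l \isn't a GRing.unit}.
  move=> _ /imsetP[r _ ->]; apply: contra xn => /unitrP[y [yrx _]].
  rewrite mulrA in yrx; have yr : y * r \is a GRing.unit by apply: finring_unit yrx.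
  by rewrite -[x](mulKr yr) yrx mulr1 unitrV.
have [u uu ub] := principle_idempotent UP (principal_left_ideal x) xu.
have Li := left_ideal_mulr u (principal_left_ideal x).
set L := [set _ | _ in _] in Li.
have Lb : {in L, forall l, l * l = l} by move=> _ /imsetP[l lL ->]; apply: ub.
have [e eL eid] := boolean_left_identity Li Lb; have [L0 LB LM] := Li.
have e0 : e != 0.
  apply: contraNneq x0 => e0; have : 1 * x * u \in L.
    by apply/imsetP; exists (1 * x); rewrite ?mem_principal_left.
  by move/eid; rewrite e0 mulr0 mul1r => xu0; rewrite -[x](mulrK uu) -xu0 mul0r.
have ee : e * e = e by apply: Lb.
have ce : (1 - e) * e = 0 by rewrite mulrBl mul1r ee subrr.
have ec : e * (1 - e) = 0 by rewrite mulrBr mulr1 ee subrr.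
(* This element lies in [L], so it equals its square, which contains the factor
   [e * (1 - e) = 0]. *)
have cre r : (1 - e) * r * e = 0.
  have yL : (1 - e) * r * e \in L by apply: LM.
  by rewrite -(Lb _ yL) !mulrA -[_ * e * (1 - e)]mulrA ec mulr0 !mul0r.
(* By [cre], [n * s * n = 0] for all [s]. So the left ideal of [n] has no units, and [n * v] is
   nilpotent for the unit [v] given by the principle; [1 - n * v] is then a unit and [n]
   vanishes. *)
have erc r : e * r * (1 - e) = 0.
  set n := e * r * (1 - e).
  have nrn s : n * s * n = 0.
    rewrite /n !mulrA -[_ * (1 - e) * s]mulrA -[_ * ((1 - e) * s) * e]mulrA.
    by rewrite cre mulr0 !mul0r.
  have nun : {in principal_left n, forall l, l \isn't a GRing.unit}.
    move=> _ /imsetP[s _ ->]; apply/negP => su.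
    have := nrn s; rewrite -mulrA => ns.
    have n0 : n = 0 by rewrite -[n](mulrK su) ns mul0r.
    by move: su; rewrite n0 mulr0 unitr0.
  have [v vu tv] := UP _ (principal_left_ideal n) nun.
  rewrite -[n]mul1r; apply: tv; first exact: mem_principal_left.
  apply: (@nilpotent_1B_unit _ 2).
  by rewrite expr2 mul1r mulrA nrn mul0r.
have central r : e * r = r * e.
  have /eqP := erc r; rewrite mulrBr mulr1 subr_eq0 => /eqP->.
  by have /eqP := cre r; rewrite !mulrBl mul1r subr_eq0 => /eqP<-.
have ccentral r : (1 - e) * r = r * (1 - e) by rewrite mulrBl mulrBr central mul1r mulr1.
have cu : {in principal_left (1 - e), forall l, l \isn't a GRing.unit}.
  move=> _ /imsetP[r _ ->]; apply: contra e0 => ru.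
  by rewrite -[e](mulKr ru) -[r * _ * e]mulrA ce !mulr0.
have [v vu vb] := principle_idempotent UP (principal_left_ideal _) cu.
(* The principle gives idempotence only after multiplication by [v]; as [1 - e] is central,
   [y * (1 - e)] is itself of that form, with [y * v^-1] for [y]. *)
move=> y; have yc : y * (1 - e) * (y * (1 - e)) = y * (1 - e).
  rewrite (_ : y * (1 - e) = y * v^-1 * (1 - e) * v).
    exact: vb (mem_principal_left _ _).
  by rewrite -mulrA ccentral -mulrA mulKr.
have ye : y * e * (y * e) = y * e by apply: Lb; apply: LM.
have pq : y * (1 - e) * (y * e) = 0.
  by rewrite -mulrA [(1 - e) * _]mulrA cre mulr0.
have qp : y * e * (y * (1 - e)) = 0.
  by rewrite -mulrA [e * (_ * _)]mulrA erc mulr0.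
have yE : y = y * (1 - e) + y * e by rewrite -mulrDr subrK mulr1.
move: (y * (1 - e)) (y * e) yc ye pq qp yE => p q pp qq pq qp ->.
by rewrite mulrDl !mulrDr pp qq pq qp addr0 add0r.
Qed.

(** Commutativity is Wedderburn's little theorem. *)
Lemma division_is_field : (forall x, x != 0 -> x \is a GRing.unit) -> is_field R.
Proof.
move=> unitR; split=> //; apply: finDomain_mulrC => x y xy0.
case: (eqVneq x 0) => //= /unitR xu; apply/eqP.
by rewrite -[y](mulKr xu) xy0 mulr0.
Qed.

End FiniteRings.

Lemma Z2_neq0 (z : 'Z_2) : z != 0 -> z = 1.
Proof. by case: z => [[|[|]]] //= ? _; apply/val_inj. Qed.

(** * Unitary Cayley graphs and the structure of finite Boolean rings *)

Section UnitaryCayley.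
Variable R : finUnitRingType.
Local Notation e := (unitary_cayley R).
Implicit Types (x y : R) (L : {set R}).

Lemma unitary_cayleyE x y : e x y = (x - y \is a GRing.unit).
Proof.
rewrite /unitary_cayley /=; case: eqP => // ->.
by rewrite subrr unitr0.
Qed.

Lemma unitary_cayley_sym : ssrbool.symmetric e.
Proof. by move=> x y; rewrite !unitary_cayleyE -unitrN opprB. Qed.

Lemma unitary_cayley_irr : irreflexive e.
Proof. by move=> x; rewrite /unitary_cayley /= eqxx. Qed.

Lemma independent_neq_setT (F : {set R}) : independent e F -> F != setT.
Proof.
move=> /independentP indF; apply/eqP => FT; have := indF 1 0.
by rewrite FT !inE unitary_cayleyE subr0 unitr1 => /(_ isT isT).
Qed.

(* A maximal independent set among the unions of cosets of [L] is a maximal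
   independent set; an exchange in it yields [u], up to translation. *)
Lemma exchange_unitary_principle : exchange_property e -> unitary_principle R.
Proof.
move=> exch L Li Ln; have [L0 LB LM] := Li.
pose P (F : {set R}) := independent e F &&
  [forall f in F, forall l in L, f + l \in F].
have PL : P L.
  apply/andP; split.
    by apply/independentP => x y xL yL; rewrite unitary_cayleyE Ln ?LB.
  apply/forall_inP => x xL; apply/forall_inP => y yL; exact: left_idealD.
have [F /maxsetP[/andP[/independentP indF /forall_inP FL] maxF] LF] := maxset_exists PL.
have {}FL f l : f \in F -> l \in L -> f + l \in F.
  by move=> fF lL; apply: (forall_inP (FL f fF)).
have Fmax : maxset (independent e) F.
  apply/maxsetP; split=> [|B /independentP indB FB]; first exact/independentP.
  apply/eqP; rewrite eqEsubset FB andbT; apply/subsetP => y yB.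
  (* A point [y] nonadjacent to [F] has its whole coset nonadjacent to [F], because [F] is stable
     under translation by [L]. *)
  pose C := F :|: [set y + l | l in L].
  suff PC : P C.
    rewrite -(maxF C PC) ?subsetUl // !inE; apply/orP; right.
    by apply/imsetP; exists 0; rewrite ?addr0.
  have yF l f : l \in L -> f \in F -> ~~ e (y + l) f.
    move=> lL fF; rewrite unitary_cayleyE -addrA -[l - f]opprB.
    rewrite -unitary_cayleyE; apply: indB => //; apply: (subsetP FB).
    by apply: FL => //; rewrite -sub0r LB.
  apply/andP; split.
    apply/independentP => u v; rewrite !inE.
    case/orP => [uF|/imsetP[l lL ->]]; case/orP => [vF|/imsetP[l' lL' ->]].
    - exact: indF.
    - by rewrite unitary_cayley_sym yF.
    - exact: yF.
    - by rewrite unitary_cayleyE opprD addrACA subrr add0r Ln ?LB.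
  apply/forall_inP => u; rewrite !inE => uC; apply/forall_inP => l lL.
  rewrite !inE; case/orP: uC => [uF|/imsetP[l' lL' ->]]; first by rewrite FL.
  apply/orP; right; apply/imsetP; exists (l' + l); first exact: left_idealD.
  by rewrite addrA.
have [|a [b [aF bF ab]]] := exch F Fmax.
  by apply: independent_neq_setT; apply/independentP.
have [f fF ebf] :=
  max_independent_neighbor unitary_cayley_sym unitary_cayley_irr Fmax bF.
have fa : f = a.
  by apply/eqP; apply: contraTT ebf => /(ab _ fF).
rewrite {f fF}fa unitary_cayleyE in ebf.
(* For [l != 0] in [L], [a + l] is an element of [F] other than [a], so [b - (a + l)] is not a unit;
   it is [1 - l * (b - a)^-1] times the unit [b - a]. *)
exists (b - a)^-1; first by rewrite unitrV.
move=> l lL lu; apply/eqP; apply: contraTT lu => l0.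
have := ab (a + l) (FL _ _ aF lL); rewrite -subr_eq0 addrAC subrr add0r.
move/(_ l0); rewrite unitary_cayleyE; apply: contra => lu.
rewrite (_ : b - (a + l) = (1 - l * (b - a)^-1) * (b - a)).
  by rewrite unitrMl.
by rewrite mulrBl mul1r divrK // opprD addrA.
Qed.

Section BooleanRing.
Hypothesis idemR : forall y : R, y * y = y.

Let setT_left_ideal : left_ideal [set: R].
Proof. by split=> [|a b _ _|r a _]; rewrite inE. Qed.

Let setT_idem : {in [set: R], forall y, y * y = y}.
Proof. by move=> y _; apply: idemR. Qed.

Lemma boolean_mulrC x y : x * y = y * x.
Proof.
exact: (boolean_comm setT_left_ideal setT_idem (in_setT x) (in_setT y)).
Qed.

Definition atoms : {set R} :=
  [set a | (a != 0) && [forall x, (a * x == 0) || (a * x == a)]].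

Lemma atomP a x : a \in atoms -> a * x = 0 \/ a * x = a.
Proof. by rewrite inE => /andP[_ /forallP/(_ x)/orP[]/eqP]; auto. Qed.

Lemma atom_neq0 a : a \in atoms -> a != 0.
Proof. by rewrite inE => /andP[]. Qed.

(** Among the nonzero elements below [x], one whose set of multiples is smallest is an atom: a
    nonzero [a * w] has the same multiples as [a], so it is [a]. *)
Lemma atom_below x : x != 0 -> exists2 a, a \in atoms & a * x != 0.
Proof.
move=> x0; pose S a := [set a * z | z : R].
pose P a := (a != 0) && (a * x == a).
have Px : P x by rewrite /P x0 idemR eqxx.
have [a /andP[a0 /eqP ax] amin] := @arg_minnP _ x P (fun a => #|S a|) Px.
exists a; last by rewrite ax.
rewrite inE a0; apply/forallP => w; case: eqP => //= /eqP aw0.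
have Paw : P (a * w) by rewrite /P aw0 -mulrA [w * x]boolean_mulrC mulrA ax eqxx.
have sub : S (a * w) \subset S a.
  by apply/subsetP => _ /imsetP[z _ ->]; apply/imsetP; exists (w * z); rewrite ?mulrA.
have /eqP SE : S (a * w) == S a by rewrite eqEcard sub amin.
have : a \in S a by apply/imsetP; exists 1; rewrite ?mulr1.
rewrite -SE => /imsetP[z _ az]; apply/eqP.
by rewrite [X in X * _]az -mulrA [z * w]boolean_mulrC mulrA -[a * w * w]mulrA idemR -az.
Qed.

Let k := #|atoms|.
Let at_ (i : 'I_k) : R := enum_val i.

Let at_in i : at_ i \in atoms. Proof. exact: enum_valP. Qed.

Definition atom_coord x : {ffun 'I_k -> 'Z_2} :=
  [ffun i => if at_ i * x == 0 then 0 else 1].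

Let coord_zmod : zmod_morphism atom_coord.
Proof.
move=> x y; apply/ffunP => i; rewrite !ffunE mulrBr.
have a0 := atom_neq0 (at_in i).
case: (atomP x (at_in i)) => ->; case: (atomP y (at_in i)) => ->;
  rewrite ?subrr ?sub0r ?oppr_eq0 ?subr0 ?eqxx ?(negPf a0) //;
  exact/val_inj.
Qed.

Let coord_monoid : monoid_morphism atom_coord.
Proof.
split.
  by apply/ffunP => i; rewrite !ffunE mulr1 (negPf (atom_neq0 (at_in i))).
move=> x y; apply/ffunP => i; rewrite !ffunE mulrA.
have a0 := atom_neq0 (at_in i).
case: (atomP x (at_in i)) => ->; case: (atomP y (at_in i)) => ->;
  rewrite ?mul0r ?eqxx ?(negPf a0) ?mulr0 ?mul0r ?mulr1 //.
Qed.

(** Finite Stone duality. The coordinates at the atoms determine an element because every nonzero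
    element has an atom below it, and sums of atoms realize all coordinates because distinct atoms
    are orthogonal. *)
Lemma boolean_isomorphic :
  exists2 k : nat, (0 < k)%N & ring_isomorphic R {ffun 'I_k -> 'Z_2}.
Proof.
exists k.
  have [a aA _] := atom_below (oner_neq0 R).
  by apply/card_gt0P; exists a.
pose f : {rmorphism R -> {ffun 'I_k -> 'Z_2}} := HB.pack atom_coord
  (GRing.isZmodMorphism.Build _ _ atom_coord coord_zmod)
  (GRing.isMonoidMorphism.Build _ _ atom_coord coord_monoid).
exists f; pose g (h : {ffun 'I_k -> 'Z_2}) := \sum_i (if h i == 0 then 0 else at_ i).
have gK : cancel g f.
  move=> h; apply/ffunP => j; rewrite ffunE /g mulr_sumr (bigD1 j) //= big1.
    rewrite addr0; case: (h j =P 0) => [->|hj]; first by rewrite mulr0 eqxx.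
    rewrite idemR (negPf (atom_neq0 (at_in j))).
    by apply/esym/Z2_neq0/eqP.
  move=> i ij; case: (h i =P 0) => _; rewrite ?mulr0 //.
  case: (atomP (at_ i) (at_in j)) => // ji.
  have := atomP (at_ j) (at_in i); rewrite [at_ i * at_ j]boolean_mulrC => -[//|].
  rewrite ji => aij.
  by move: ij; rewrite (enum_val_inj aij) eqxx.
exists g => // x; have f_inj : injective f.
  apply: raddf_inj => y fy; apply/eqP/negPn/negP => /atom_below[a aA] /eqP[].
  have := congr1 (fun h : {ffun _} => h (enum_rank_in aA a)) fy.
  by rewrite !ffunE /at_ enum_rankK_in //; case: eqP.
by apply: f_inj; rewrite gK.
Qed.

End BooleanRing.

Lemma exchange_classification : exchange_property e ->
  is_field R \/ exists2 k : nat, (0 < k)%N & ring_isomorphic R {ffun 'I_k -> 'Z_2}.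
Proof.
move=> /exchange_unitary_principle UP.
case: (pselect (forall x : R, x != 0 -> x \is a GRing.unit)).
  by move=> unitR; left; apply: division_is_field.
move/existsNP => [x /not_implyP[x0 /negP xn]]; right.
exact: boolean_isomorphic (unitary_principle_boolean UP x0 xn).
Qed.

End UnitaryCayley.

(** A disjoint union of cliques, namely the fibres of [c]. *)
Definition cluster_graph (T : finType) (e : rel T) : Prop :=
  exists (C : finType) (c : T -> C), forall x y, e x y = (x != y) && (c x == c y).

(** Over a field the graph is one clique. In a power of ['Z_2] the only unit is 1, so the cliques
    are the pairs of [x] and [x + 1], and the pair itself labels its class. *)
Lemma classification_cluster (R : finUnitRingType) :
  (is_field R \/
   exists2 k : nat, (0 < k)%N & ring_isomorphic R {ffun 'I_k -> 'Z_2}) ->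
  cluster_graph (unitary_cayley R).
Proof.
case=> [[_ unitR]|[k k0 [f [g fK gK]]]].
  exists unit, (fun=> tt) => x y; rewrite unitary_cayleyE eqxx andbT.
  by case: eqP => [->|/eqP]; [rewrite subrr unitr0 | rewrite -subr_eq0 => /unitR].
have add2 (x : R) : x + x = 0.
  apply: (can_inj fK); rewrite rmorphD rmorph0; apply/ffunP => i.
  rewrite !ffunE; case: (f x i =P 0) => [->|/eqP/Z2_neq0->].
    exact: addr0.
  exact/val_inj.
have unit1 (u : R) : (u \is a GRing.unit) = (u == 1).
  apply/idP/eqP => [/unitrP[v [vu _]]|->]; last exact: unitr1.
  apply: (can_inj fK); rewrite rmorph1; apply/ffunP => i.
  move: (congr1 (fun h : {ffun _} => h i) (congr1 f vu)).
  rewrite rmorphM rmorph1 !ffunE.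
  by move=> vu1; apply: Z2_neq0; apply: contra_eqN vu1 => /eqP->; rewrite mulr0.
have oppE (x : R) : - x = x by apply/esym/eqP; rewrite -addr_eq0 add2.
exists {set R}, (fun x => [set x; x + 1]) => x y.
rewrite unitary_cayleyE unit1.
apply/eqP/andP => [xy|[xy /eqP cxy]].
  have -> : x = y + 1 by rewrite -xy addrC subrK.
  rewrite -subr_eq0 addrAC subrr add0r oner_eq0; split=> //.
  by rewrite -addrA add2 addr0 setUC.
have : x \in [set y; y + 1] by rewrite -cxy !inE eqxx.
by rewrite !inE (negPf xy) /= => /eqP->; rewrite addrAC subrr add0r.
Qed.

(** * Disjoint unions of cliques *)

Section Clusters.
Variables (T C : finType) (e : rel T) (c : T -> C).
Hypothesis eE : forall x y, e x y = (x != y) && (c x == c y).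

Lemma cluster_independentP (F : {set T}) :
  reflect {in F &, injective c} (independent e F).
Proof.
apply: (iffP (independentP _ _)) => [indF x y xF yF cxy|injF x y xF yF].
  by apply/eqP; have := indF x y xF yF; rewrite eE cxy eqxx andbT negbK.
by rewrite eE negb_and negbK; case: eqP => //= /eqP; apply: contraNN => /eqP/injF->.
Qed.

Lemma cluster_maxP (F : {set T}) :
  reflect ({in F &, injective c} /\ forall x, exists2 y, y \in F & c y = c x)
          (maxset (independent e) F).
Proof.
have e_sym : ssrbool.symmetric e by move=> x y; rewrite !eE eq_sym [c x == _]eq_sym.
have e_irr : irreflexive e by move=> x; rewrite eE eqxx.
apply: (iffP idP) => [maxF|[injF totF]].
  split; first by apply/cluster_independentP; case/maxsetP: maxF.
  move=> x; case: (boolP (x \in F)) => [|xF]; first by exists x.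
  have [y yF] := max_independent_neighbor e_sym e_irr maxF xF.
  by rewrite eE => /andP[_ /eqP]; exists y.
apply/maxsetP; split=> [|B /cluster_independentP injB FB].
  exact/cluster_independentP.
apply/eqP; rewrite eqEsubset FB andbT; apply/subsetP => x xB.
have [y yF cyx] := totF x.
by rewrite -(injB y x) // (subsetP FB).
Qed.

Lemma cluster_card (F : {set T}) :
  maxset (independent e) F -> #|F| = #|c @: setT|.
Proof.
case/cluster_maxP => injF totF; rewrite -(card_in_imset injF).
apply: eq_card => z; apply/imsetP/imsetP => -[x _ ->]; first by exists x.
by have [y yF <-] := totF x; exists y.
Qed.

Lemma cluster_well_covered : well_covered e.
Proof. by move=> A B /cluster_card-> /cluster_card->. Qed.

Let weight (F : {set T}) := (\sum_(x in F) enum_rank x)%N.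

(* Exchanging [v] for the smaller [v'] in [F] gives an earlier facet. *)
Lemma cluster_decrease (F X : {set T}) :
  maxset (independent e) F -> maxset (independent e) X ->
  F != X -> (weight X <= weight F)%N ->
  exists v Y, [/\ v \in F, v \notin X, maxset (independent e) Y,
                  F :\ v \subset Y & (weight Y < weight F)%N].
Proof.
move=> /cluster_maxP[injF totF] /cluster_maxP[injX totX] FX wXF.
have /choice[t tP] : forall x, exists y, y \in X /\ c y = c x.
  by move=> x; have [y] := totX x; exists y.
have t_inj : {in F &, injective t}.
  by move=> x y xF yF txy; apply: injF => //; rewrite -(tP x).2 -(tP y).2 txy.
have XE : X = t @: F.
  apply/setP => x; apply/idP/imsetP => [xX|[y _ ->]]; last exact: (tP y).1.
  have [y yF cyx] := totF x; exists y => //.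
  by apply: injX => //; [exact: (tP y).1 | rewrite (tP y).2].
(* If [t] never lowered the rank, [X] would weigh at least as much as [F], with equality only when
   [t] fixes [F] pointwise, that is when [X = F]. *)
have [v vF vlt] : exists2 v, v \in F & (enum_rank (t v) < enum_rank v)%N.
  apply: contrapT => nex.
  have le v : v \in F -> (enum_rank v <= enum_rank (t v) ?= iff (t v == v))%N.
    move=> vF; split; first by rewrite leqNgt; apply/negP => vlt; apply: nex; exists v.
    by rewrite -[RHS](inj_eq enum_rank_inj) [RHS]eq_sym.
  have wX : weight X = (\sum_(x in F) enum_rank (t x))%N.
    by rewrite /weight [in LHS]XE big_imset.
  have [_] := leqif_sum le; rewrite -wX eqn_leq wXF andbT.
  have -> : (\sum_(x in F) enum_rank x <= weight X)%N.
    by rewrite wX; apply: leq_sum => v /le[].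
  move=> /esym/forall_inP tv; case/eqP: FX; rewrite XE.
  apply/setP => x; apply/idP/imsetP => [xF|[y yF ->]].
    by exists x => //; rewrite (eqP (tv x xF)).
  by rewrite (eqP (tv y yF)).
have tvF : t v \notin F.
  apply: contraL vlt => tF; rewrite -leqNgt.
  by rewrite (injF (t v) v) // (tP v).2.
exists v, (t v |: F :\ v); split=> //.
- by apply: contraNN tvF => vX; rewrite (injX (t v) v) ?(tP v).1 ?(tP v).2.
- apply/cluster_maxP; split.
    move=> x y; rewrite !inE => /orP[/eqP->|/andP[xv xF]] /orP[/eqP->|/andP[yv yF]] //.
    + by rewrite (tP v).2 => /injF H; rewrite H ?eqxx in yv.
    + by rewrite (tP v).2 => /injF H; rewrite H ?eqxx in xv.
    + exact: injF.
  move=> x; have [y yF cyx] := totF x; case: (eqVneq y v) => [yv|yv].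
    by exists (t v); rewrite ?setU11 // (tP v).2 -yv.
  by exists y => //; rewrite !inE yv yF orbT.
- exact: subsetUr.
rewrite /weight (big_setD1 v vF) /= big_setU1 ?ltn_add2r //=.
by rewrite !inE (negPf tvF) andbF.
Qed.

(** A facet [H] of the intersection with the earlier facets lies in an earlier [X]. Then
    [cluster_decrease] gives a vertex [v] outside [X] such that [Fi :\ v] lies in a lighter, hence
    earlier, facet; it contains [H], so it equals [H] by maximality. *)
Lemma cluster_shellable : shellable_graph e.
Proof.
have facetE X : facet (Ind e) X = maxset (independent e) X.
  by apply: maxset_eq => Y; rewrite /= inE.
pose r := relpre weight leq.
pose s := sort r (enum [pred F | facet (Ind e) F]).
have sP F : (F \in s) = facet (Ind e) F by rewrite mem_sort mem_enum.
have us : uniq s by rewrite sort_uniq enum_uniq.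
have s_sorted : sorted r s by apply: sort_sorted => x y; apply: leq_total.
have r_tr : ssrbool.transitive r by move=> x y z; apply: leq_trans.
have r_refl : reflexive r by move=> x; apply: leqnn.
exists s; split=> // i /andP[i0 is_] Fi.
have smax j : (j < size s)%N -> maxset (independent e) (nth set0 s j).
  by move=> js; rewrite -facetE -sP mem_nth.
move=> H; set D := _ :&: _ => Hfacet.
have [HD maxH] := maxsetP Hfacet; move: HD.
rewrite !inE /= orbF => /andP[/hasP[X /(nthP set0)[j]]].
rewrite size_take is_ => ji; rewrite nth_take // => XE HX HFi.
have js : (j < size s)%N by apply: ltn_trans ji is_.
have [||||v [Y [vF vX Ymax FY wY]]] := @cluster_decrease Fi X.
- exact: smax.
- by rewrite -XE; apply: smax.
- by rewrite -XE nth_uniq // neq_ltn ji orbT.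
- by rewrite -XE; apply: (sorted_leq_nth r_tr r_refl set0 s_sorted); rewrite ?inE // ltnW.
have Ys : Y \in s by rewrite sP facetE.
have Yi : (index Y s < i)%N.
  rewrite ltnNge; apply: contraL wY => iY; rewrite -leqNgt -(nth_index set0 Ys).
  by apply: (sorted_leq_nth r_tr r_refl set0 s_sorted); rewrite ?inE ?index_mem.
have HE : Fi :\ v = H.
  apply: maxH; last first.
    by rewrite subsetD1 HFi; apply: contra vX; apply: (subsetP HX).
  rewrite !inE /= orbF subsetDl andbT; apply/hasP; exists Y => //.
  by rewrite -(nth_index set0 Ys) -(nth_take set0 Yi) mem_nth // size_take is_.
by apply/face_dim_pred; rewrite -HE (cardsD1 v Fi) vF.
Qed.

End Clusters.

(** * Algebraic relations in edge rings *)

Section Relations.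
Variables (K : fieldType) (A : comNzRingType) (k : {rmorphism K -> A}).

Fixpoint word_monomial (a : seq A) (w : seq nat) : A :=
  match a, w with
  | x :: a', n :: w' => x ^+ n * word_monomial a' w'
  | _, _ => 1
  end.

Fixpoint words (r D : nat) : seq (seq nat) :=
  if r is r'.+1 then [seq n :: w | n <- iota 0 D, w <- words r' D] else [:: [::]].

Lemma size_words r D : size (words r D) = (D ^ r)%N.
Proof. by elim: r => //= r IH; rewrite size_allpairs size_iota IH expnS. Qed.

Lemma words_uniq r D : uniq (words r D).
Proof.
elim: r => //= r IH; apply: allpairs_uniq => //; first exact: iota_uniq.
by move=> [n w] [n' w'] _ _ [-> ->].
Qed.

(* The lowest nonzero coefficients of an algebraic relation climb the chain. *)
Lemma relation_climb (a : seq A) (D : nat) (I : nat -> A -> Prop) (q : seq nat -> K) :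
  (forall i, (i <= size a)%N -> is_ideal (I i)) ->
  (forall i, (i < size a)%N -> forall x, I i x -> I i.+1 x) ->
  (forall i, (i < size a)%N -> forall x, I i (a`_i * x) -> I i x) ->
  (forall i, (i < size a)%N -> I i.+1 a`_i) ->
  I 0%N (\sum_(w <- words (size a) D) k (q w) * word_monomial a w) ->
  (exists2 w, w \in words (size a) D & q w != 0) -> I (size a) 1.
Proof.
elim: a I q => [|x a IH] I q Iid Isub Ireg Iin /=.
  rewrite big_seq1 mulr1 => Iq [w]; rewrite inE => /eqP-> q0.
  have [_ _ IM] := Iid 0%N isT.
  by have := IM (k (q [::])^-1) _ Iq; rewrite -rmorphM mulVf // rmorph1.
pose S n := \sum_(w <- words (size a) D) k (q (n :: w)) * word_monomial a w.
have -> : \sum_(w <- words (size a).+1 D) k (q w) * word_monomial (x :: a) w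
    = \sum_(0 <= n < D) x ^+ n * S n.
  rewrite /= big_allpairs_dep /= /index_iota subn0; apply: eq_bigr => n _.
  by rewrite /S mulr_sumr; apply: eq_bigr => w _; rewrite mulrCA.
move=> Isum exq.
pose P n := has (fun w => q (n :: w) != 0) (words (size a) D).
have exP : exists n, P n && (n < D)%N.
  case: exq => _ /allpairsP[[n w] /= [nD wW ->]] qw; exists n.
  by move: nD; rewrite mem_iota add0n /= => ->; rewrite andbT; apply/hasP; exists w.
(* The lowest exponent of [x] with a nonzero coefficient. Cancelling [x ^+ n0] modulo [I 0] leaves
   [S n0] plus a multiple of [x]; since [x] is in [I 1], so is [S n0], a nontrivial expression in
   the remaining elements. *)
case: (ex_minnP exP) => n0 /andP[/hasP[w0 w0W qw0] n0D] n0min.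
have S0 n : (n < n0)%N -> S n = 0.
  move=> nn0; rewrite /S big_seq big1 // => w wW.
  case: (eqVneq (q (n :: w)) 0) => [->|qw]; first by rewrite rmorph0 mul0r.
  have : (n0 <= n)%N.
    by apply: n0min; rewrite (ltn_trans nn0) // andbT; apply/hasP; exists w.
  by rewrite leqNgt nn0.
have [IO0 IOD IOM] := Iid 0%N isT; have I1 : is_ideal (I 1%N) by apply: Iid.
pose R := \sum_(n0.+1 <= n < D) x ^+ (n - n0.+1) * S n.
have sumE : \sum_(0 <= n < D) x ^+ n * S n = x ^+ n0 * (S n0 + x * R).
  rewrite (@big_cat_nat _ _ _ n0) //= ?(ltnW n0D) //.
  rewrite big_nat_cond big1 ?add0r => [|n /andP[/andP[_ nn0] _]]; last first.
    by rewrite S0 // mulr0.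
  rewrite big_ltn // mulrDr; congr (_ + _); rewrite mulrA /R mulr_sumr.
  rewrite -exprSr; apply: eq_big_nat => n /andP[n0n _].
  by rewrite mulrA -exprD subnKC.
have ISR : I 0%N (S n0 + x * R).
  move: Isum; rewrite sumE; move: (S n0 + x * R) => y.
  elim: (n0) => [|n IHn]; first by rewrite mul1r.
  by rewrite exprS -mulrA => /(Ireg 0%N isT)/IHn.
apply: (IH (fun i => I i.+1) (fun w => q (n0 :: w))).
- by move=> i ia; apply: Iid.
- by move=> i ia; apply: (Isub i.+1).
- by move=> i ia; apply: (Ireg i.+1).
- by move=> i ia; apply: (Iin i.+1).
- rewrite -/(S n0) -[S n0](addrK (x * R)); apply: ideal_sub => //.
    exact: (Isub 0%N).
  by apply: ideal_mulr => //; apply: (Iin 0%N).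
by exists w0.
Qed.

Lemma linear_dependence (m n : nat) (F : 'I_m -> A) (B : 'I_n -> A) :
  (forall i, exists c : 'I_n -> K, F i = \sum_j k (c j) * B j) -> (n < m)%N ->
  exists2 q : 'I_m -> K, \sum_i k (q i) * F i = 0 & exists i, q i != 0.
Proof.
move=> /choice[c FE] nm; pose M := \matrix_(i < m, j < n) c i j.
have : kermx M != 0.
  rewrite kermx_eq0 /row_free neq_ltn; apply/orP; left.
  exact: leq_ltn_trans (rank_leq_col M) nm.
case/rowV0Pn => v /sub_kermxP vM v0; exists (fun i => v 0 i).
  under eq_bigr do rewrite FE mulr_sumr.
  rewrite exchange_big big1 //= => j _.
  under eq_bigr do rewrite mulrA -rmorphM.
  rewrite -mulr_suml -rmorph_sum.
  have := congr1 (fun u : 'rV_n => u 0 j) vM; rewrite !mxE.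
  under eq_bigr do rewrite mxE.
  by move=> ->; rewrite rmorph0 mul0r.
by case/rV0Pn: v0 => i; exists i.
Qed.

End Relations.

(** * Growth of edge rings and bounds on depth and dimension *)

Section Growth.
Variables (T : finType) (e : rel T) (K : fieldType).
Local Notation A := (edge_ring e K).
Local Notation c_ := (edge_const e K).
Local Notation x_ := (edge_var e K).

Definition edge_monomial (u : T -> nat) : A := \prod_v x_ v ^+ u v.

(** Each exponent, rather than the total degree, is bounded by [N], so the monomials are indexed by
    finite functions. *)
Definition edge_filtration N (a : A) : Prop :=
  exists c : {ffun T -> 'I_N.+1} -> K, a = \sum_u c_ (c u) * edge_monomial (fun v => u v).

Lemma edge_filtration0 N : edge_filtration N 0.
Proof. by exists (fun=> 0); rewrite big1 // => u _; rewrite rmorph0 mul0r. Qed.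

Lemma edge_filtrationD N a b :
  edge_filtration N a -> edge_filtration N b -> edge_filtration N (a + b).
Proof.
move=> [c ->] [d ->]; exists (fun u => c u + d u).
by rewrite -big_split; apply: eq_bigr => u _; rewrite rmorphD mulrDl.
Qed.

Lemma edge_filtrationZ N k a :
  edge_filtration N a -> edge_filtration N (c_ k * a).
Proof.
move=> [c ->]; exists (fun u => k * c u).
by rewrite mulr_sumr; apply: eq_bigr => u _; rewrite rmorphM mulrA.
Qed.

Lemma edge_filtration_monomial N (u : T -> nat) :
  (forall v, (u v <= N)%N) -> edge_filtration N (edge_monomial u).
Proof.
move=> uN; pose u' := [ffun v => inord (u v) : 'I_N.+1].
exists (fun w => (w == u')%:R).
rewrite (bigD1 u') //= eqxx rmorph1 mul1r big1 ?addr0 => [|w /negPf->]; last first.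
  by rewrite rmorph0 mul0r.
by apply: eq_bigr => v _; rewrite ffunE inordK // ltnS.
Qed.

Lemma edge_filtration_sum N (J : Type) (r : seq J) (P : pred J) (F : J -> A) :
  (forall j, P j -> edge_filtration N (F j)) ->
  edge_filtration N (\sum_(j <- r | P j) F j).
Proof.
move=> NF; apply: (big_ind (edge_filtration N)) => //.
  exact: edge_filtration0.
exact: edge_filtrationD.
Qed.

Lemma edge_filtrationM N N' a b : edge_filtration N a -> edge_filtration N' b ->
  edge_filtration (N + N') (a * b).
Proof.
move=> [c ->] [d ->]; rewrite mulr_suml; apply: edge_filtration_sum => u _.
rewrite mulr_sumr; apply: edge_filtration_sum => w _.
rewrite mulrACA -rmorphM; apply: edge_filtrationZ.
rewrite /edge_monomial -big_split /=.
under eq_bigr do rewrite -exprD.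
apply: (@edge_filtration_monomial _ (fun v => u v + w v)%N) => v.
by rewrite leq_add // -ltnS.
Qed.

Lemma edge_filtration_le N N' a : (N <= N')%N ->
  edge_filtration N a -> edge_filtration N' a.
Proof.
move=> le [c ->]; apply: edge_filtration_sum => u _; apply: edge_filtrationZ.
by apply: edge_filtration_monomial => v; rewrite (leq_trans _ le) // -ltnS.
Qed.

Lemma edge_filtration1 N : edge_filtration N 1.
Proof.
have := @edge_filtration_monomial N (fun=> 0%N) (fun=> leq0n N).
by rewrite /edge_monomial big1.
Qed.

Lemma edge_filtrationX N a n :
  edge_filtration N a -> edge_filtration (n * N) (a ^+ n).
Proof.
move=> Na; elim: n => [|n IH]; first exact: edge_filtration1.
by rewrite exprS mulSn; apply: edge_filtrationM.
Qed.

Lemma edge_filtration_exhaustive a : exists N, edge_filtration N a.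
Proof.
elim/edge_ring_ind: a => [k|v|a b [N Na] [N' Nb]|a b [N Na] [N' Nb]].
- by exists 0%N; rewrite -[c_ k]mulr1; apply/edge_filtrationZ/edge_filtration1.
- exists 1%N; have := @edge_filtration_monomial 1 (fun w => w == v).
  rewrite /edge_monomial (bigD1 v) //= eqxx big1 ?mulr1 => [|w /negPf->] //.
  by apply=> w; case: eqP.
- exists (N + N')%N; apply: edge_filtrationD.
    by apply: edge_filtration_le Na; rewrite leq_addr.
  by apply: edge_filtration_le Nb; rewrite leq_addl.
- by exists (N + N')%N; apply: edge_filtrationM.
Qed.

Variable alpha : nat.
Hypothesis e_irr : irreflexive e.
Hypothesis le_alpha : forall F : {set T}, independent e F -> (#|F| <= alpha)%N.

Let support N (u : {ffun T -> 'I_N.+1}) := [set v | u v != ord0].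
Let good N := [set u : {ffun T -> 'I_N.+1} | independent e (support u)].

Let edge_monomial_eq0 N (u : {ffun T -> 'I_N.+1}) :
  u \notin good N -> edge_monomial (fun v => u v) = 0.
Proof.
rewrite inE => /independentP nind.
have [v [w [vs ws evw]]] : exists v w, [/\ v \in support u, w \in support u & e v w].
  apply: contrapT => nex; apply: nind => v w vs ws; apply/negP => evw.
  by apply: nex; exists v, w.
move: vs ws; rewrite !inE => v0 w0.
have pos z : u z != ord0 -> exists n, u z = n.+1 :> nat.
  by case: (u z) => [[|n] ?] // _; exists n.
have [n vn] := pos v v0; have [m wm] := pos w w0.
have wv : w != v by apply: contraTneq evw => ->; rewrite e_irr.
rewrite /edge_monomial (bigD1 v) //= (bigD1 w) //= vn wm !exprS.
by rewrite mulrA mulrACA edge_var_mul // !mul0r.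
Qed.

(** Sort by support: there are at most [2 ^ #|T|] supports, and each independent one, having at most
    [alpha] vertices, carries at most [N.+1 ^ alpha] exponent functions. *)
Let card_good N : (#|good N| <= 2 ^ #|T| * N.+1 ^ alpha)%N.
Proof.
rewrite -sum1_card (partition_big (@support N) (independent e)) /= => [|u]; last first.
  by rewrite inE.
have -> : (2 ^ #|T| * N.+1 ^ alpha = \sum_(F : {set T}) N.+1 ^ alpha)%N.
  rewrite sum_nat_const; congr (_ * _)%N.
  by rewrite -cardsT -card_powerset; apply: eq_card => F; rewrite inE subsetT.
rewrite big_mkcond; apply: leq_sum => F _; case: ifP => // indF.
rewrite sum1_card; apply: leq_trans (leq_pexp2l (ltn0Sn N) (le_alpha indF)).
rewrite -[X in (X ^ _)%N](card_ord N.+1) -(card_pffun_on ord0 F).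
apply: subset_leq_card; apply/subsetP => u; rewrite unfold_in => /andP[_ /eqP uF].
apply/pffun_onP; split; last by move=> z _; rewrite inE.
by apply/subsetP => v; rewrite -uF !inE.
Qed.

(** A dimension count: the [D ^ alpha.+1] monomials in [a] with exponents below [D] lie in a space
    whose dimension is at most a constant times [D ^ alpha]. *)
Lemma edge_relation (a : seq A) : size a = alpha.+1 ->
  exists D (q : seq nat -> K),
    \sum_(w <- words (size a) D) c_ (q w) * word_monomial a w = 0 /\
    exists2 w, w \in words (size a) D & q w != 0.
Proof.
move=> sa.
have [E aE] : exists E, forall b, b \in a -> edge_filtration E b.
  elim: (a) => [|b l [E lE]]; first by exists 0%N.
  have [E' bE'] := edge_filtration_exhaustive b.
  exists (E + E')%N => d; rewrite inE => /predU1P[->|dl].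
    by apply: edge_filtration_le bE'; rewrite leq_addl.
  by apply: edge_filtration_le (lE d dl); rewrite leq_addr.
(* With [N] as below, [N.+1 <= D * (alpha.+1 * E + 1)]; one factor [D] of [D ^ alpha.+1] thus has to
   exceed the remaining constant. *)
have [D ltD] : exists D, (2 ^ #|T| * (alpha.+1 * E + 1) ^ alpha < D)%N.
  by exists (2 ^ #|T| * (alpha.+1 * E + 1) ^ alpha).+1.
have D0 : (0 < D)%N by apply: leq_ltn_trans ltD.
pose N := (alpha.+1 * (D * E))%N.
have wordN w : w \in words (size a) D -> edge_filtration N (word_monomial a w).
  rewrite /N -sa; elim: (a) w aE => [|b l IH] w lE /=.
    by move=> _; apply: edge_filtration1.
  case/allpairsP => [[n w'] /= [nD wW ->]]; rewrite mulSn; apply: edge_filtrationM.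
    apply: edge_filtration_le (edge_filtrationX n (lE b (mem_head _ _))).
    by rewrite leq_mul2r; move: nD; rewrite mem_iota add0n => /ltnW->; rewrite orbT.
  by apply: IH => // d dl; apply: lE; rewrite inE dl orbT.
have ltND : (2 ^ #|T| * N.+1 ^ alpha < size (words (size a) D))%N.
  rewrite size_words sa.
  have leN : (N.+1 <= D * (alpha.+1 * E + 1))%N by move: D0; rewrite /N; clear; nia.
  apply: (@leq_ltn_trans (2 ^ #|T| * (D * (alpha.+1 * E + 1)) ^ alpha)).
    rewrite leq_mul2l; apply/orP; right.
    by case: (posnP alpha) => [->|a0]; rewrite ?expn0 // leq_exp2r.
  by rewrite expnMn mulnCA expnSr ltn_mul2l expn_gt0 D0.
pose W := words (size a) D.
pose B (j : 'I_#|good N|) := edge_monomial (fun v => (enum_val j) v).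
have spanB w : w \in W -> exists d : 'I_#|good N| -> K,
    word_monomial a w = \sum_j c_ (d j) * B j.
  move=> /wordN[d ->]; exists (fun j => d (enum_val j)).
  rewrite (bigID (mem (good N))) /= [X in _ + X]big1 ?addr0 => [|u nu].
    by rewrite big_enum_val.
  by rewrite edge_monomial_eq0 // mulr0.
have [i||] := linear_dependence (k := c_)
    (F := fun i : 'I_(size W) => word_monomial a (nth [::] W i)) (B := B).
- exact: spanB (mem_nth _ (ltn_ord i)).
- exact: leq_ltn_trans (card_good N) ltND.
move=> q qw [i qi].
exists D, (fun w => if insub (index w W) is Some j then q j else 0).
have qE (j : 'I_(size W)) :
    (if insub (index (nth [::] W j) W) is Some j then q j else 0) = q j.
  by rewrite index_uniq ?words_uniq // valK.
split; last by exists (nth [::] W i); rewrite ?mem_nth // qE.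
rewrite -/W (big_nth [::]) big_mkord -[RHS]qw; apply: eq_bigr => j _.
by rewrite qE.
Qed.

(** The common source of the bounds on regular sequences and on chains of primes: an algebraic
    relation among the first [alpha.+1] elements climbs the chain of ideals to a nonzero
    constant. *)
Lemma edge_chain_bound (a : seq A) (I : nat -> A -> Prop) :
  (alpha < size a)%N ->
  (forall i, (i <= size a)%N -> is_ideal (I i)) ->
  (forall i, (i < size a)%N -> forall x, I i x -> I i.+1 x) ->
  (forall i, (i < size a)%N -> forall x, I i (a`_i * x) -> I i x) ->
  (forall i, (i < size a)%N -> I i.+1 a`_i) -> I alpha.+1 1.
Proof.
move=> lta Iid Isub Ireg Iin; pose b := take alpha.+1 a.
have sb : size b = alpha.+1 by rewrite size_takel.
have [D [q [q0 qn]]] := edge_relation sb.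
have lt i : (i < alpha.+1)%N -> (i < size a)%N by move/leq_trans; apply.
rewrite -sb; apply: (relation_climb (k := c_) (D := D) (q := q)); rewrite ?sb.
- by move=> i ib; apply: Iid; apply: leq_trans ib lta.
- by move=> i /lt/Isub.
- by move=> i ib; rewrite nth_take //; apply: Ireg; apply: lt.
- by move=> i ib; rewrite nth_take //; apply: Iin; apply: lt.
- by rewrite -sb q0; case: (Iid 0%N (leq0n _)).
- by rewrite -sb.
Qed.

Lemma edge_regular_bound (s : seq A) : regular_seq s -> (size s <= alpha)%N.
Proof.
move=> [reg prop]; rewrite leqNgt; apply/negP => lts; apply: prop.
apply: (@span_cat_sub _ (take alpha.+1 s)); first exact: mem_take.
apply: (@edge_chain_bound s (fun i => in_span (take i s)) lts).
- by move=> i _; apply: span_ideal.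
- move=> i si x; apply: span_cat_sub => g gi.
  by rewrite (take_nth 0) // mem_rcons inE gi orbT.
- exact: reg.
- by move=> i si; apply: mem_span; rewrite (take_nth 0) // mem_rcons mem_head.
Qed.

(** An element of [P i.+1] outside [P i] can be cancelled modulo the prime [P i], so such elements
    play the part of a regular sequence. *)
Lemma edge_chain_length (M : {pred A}) d P :
  prime_chain_in M d P -> (d <= alpha)%N.
Proof.
move=> [Pp Pstrict _]; rewrite leqNgt; apply/negP => ltd.
have /choice[a aP] : forall i, exists a, (i < d)%N -> a \in P i.+1 /\ a \notin P i.
  move=> i; case: (pselect (i < d)%N) => [/Pstrict[_ /existsNP[a /not_implyP[a1 a0]]]|ni].
    by exists a => _; split=> //; apply/negP.
  by exists 0.
have [[_ P1 _] _] := Pp alpha.+1 ltd; case/negP: P1.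
have sz : size (mkseq a d) = d by rewrite size_mkseq.
apply: (@edge_chain_bound (mkseq a d) (fun i x => x \in P i)); rewrite sz //.
- by move=> i /Pp[/idealr_closed_ideal].
- by move=> i /Pstrict[].
- move=> i id x; rewrite nth_mkseq // => /((Pp i (ltnW id)).2 _ _).
  by rewrite (negPf (aP i id).2).
- by move=> i id; rewrite nth_mkseq //; apply: (aP i id).1.
Qed.

End Growth.

(** * Hilbert's basis theorem *)

Section Generation.
Variable A : comNzRingType.

Definition horner_rmorph (P : comNzRingType) (f : {rmorphism P -> A}) (x : A) :
    {rmorphism {poly P} -> A} :=
  horner_morph (fun y => mulrC x (f y)).

Lemma horner_rmorphE (P : comNzRingType) (f : {rmorphism P -> A}) x p :
  horner_rmorph f x p = (map_poly f p).[x].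
Proof. by []. Qed.

Lemma horner_rmorphC (P : comNzRingType) (f : {rmorphism P -> A}) x a :
  horner_rmorph f x a%:P = f a.
Proof. exact: horner_morphC. Qed.

Lemma horner_rmorphX (P : comNzRingType) (f : {rmorphism P -> A}) x :
  horner_rmorph f x 'X = x.
Proof. exact: horner_morphX. Qed.

(** The subring generated by the image of [f] and by [l]. Each generator replaces the base [P] by
    [{poly P}], so statements about one polynomial variable extend by induction on [l] over a
    varying base. *)
Fixpoint ring_gen (l : seq A) (P : comNzRingType) (f : {rmorphism P -> A}) :
    A -> Prop :=
  if l is x :: l' then ring_gen l' (horner_rmorph f x)
  else fun a => exists p, a = f p.

Lemma ring_gen_base l (P : comNzRingType) (f : {rmorphism P -> A}) p :
  ring_gen l f (f p).
Proof.
elim: l P f p => [|x l IH] P f p /=; first by exists p.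
by rewrite -(horner_rmorphC f x); apply: IH.
Qed.

Lemma ring_gen_mem l (P : comNzRingType) (f : {rmorphism P -> A}) x :
  x \in l -> ring_gen l f x.
Proof.
elim: l P f => //= y l IH P f; rewrite inE => /predU1P[->|xl]; last exact: IH.
by rewrite -{2}(horner_rmorphX f y); apply: ring_gen_base.
Qed.

Lemma ring_gen_closed l (P : comNzRingType) (f : {rmorphism P -> A}) a b :
  ring_gen l f a -> ring_gen l f b -> ring_gen l f (a + b) /\ ring_gen l f (a * b).
Proof.
elim: l P f => [|x l IH] P f /=; last exact: IH.
move=> [p ->] [q ->]; split; first by exists (p + q); rewrite rmorphD.
by exists (p * q); rewrite rmorphM.
Qed.

Lemma ring_gen_sub l (P : comNzRingType) (f : {rmorphism P -> A}) (S : A -> Prop) :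
  (forall p, S (f p)) -> {in l, forall x, S x} ->
  (forall a b, S a -> S b -> S (a + b)) -> (forall a b, S a -> S b -> S (a * b)) ->
  forall a, ring_gen l f a -> S a.
Proof.
move=> + + SD SM; elim: l P f => [|x l IH] P f Sf Sl /=; first by move=> a [p ->].
apply: IH => [p|y yl]; last by apply: Sl; rewrite inE yl orbT.
have Sx : S x by apply: Sl; rewrite mem_head.
elim/poly_ind: p => [|p c Sp]; first by rewrite rmorph0 -(rmorph0 f).
rewrite rmorphD rmorphM horner_rmorphX horner_rmorphC.
by apply: (SD) => //; apply: SM.
Qed.

End Generation.

Section Noetherian.

Definition all_ideals_fg (B : comNzRingType) : Prop :=
  forall I : B -> Prop, is_ideal I ->
    exists2 gs, {in gs, forall g, I g} & forall a, I a -> in_span gs a.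

Lemma all_ideals_fg_noetherian B : all_ideals_fg B -> noetherian B.
Proof.
move=> fgB I /idealr_closed_ideal II; have [gs gI Igs] := fgB _ II.
by exists gs => a; split; [apply: Igs | apply: span_sub II gI].
Qed.

Lemma all_ideals_fg_field (K : fieldType) : all_ideals_fg K.
Proof.
move=> I II; have [I0 ID IM] := II.
case: (pselect (exists2 a, I a & a != 0)) => [[a Ia a0]|nex].
  have [_ _ JM] := span_ideal [:: a].
  exists [:: a] => [g|b _]; first by rewrite inE => /eqP->.
  by rewrite -(divfK a0 b); apply: JM; apply: mem_span; apply: mem_head.
exists [::] => // a Ia; case: (eqVneq a 0) => [->|a0]; last by case: nex; exists a.
by have [J0 _ _] := @span_ideal K [::].
Qed.

Lemma span_map (B C : comNzRingType) (f : {rmorphism B -> C}) gs a :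
  in_span gs a -> in_span [seq f g | g <- gs] (f a).
Proof.
have [J0 JD JM] := span_ideal [seq f g | g <- gs].
apply: (@span_sub _ (fun a => in_span [seq f g | g <- gs] (f a))) => [|g ggs].
  split=> [|x y xJ yJ|x y yJ]; rewrite ?rmorph0 ?rmorphD ?rmorphM //.
    exact: JD.
  exact: JM.
by apply: mem_span; apply: map_f.
Qed.

Lemma all_ideals_fg_image (B C : comNzRingType) (f : {rmorphism B -> C}) :
  (forall c, exists b, c = f b) -> all_ideals_fg B -> all_ideals_fg C.
Proof.
move=> surj fgB I [I0 ID IM].
have [|gs gI Igs] := fgB (fun b => I (f b)).
  split=> [|x y xJ yJ|x y yJ]; rewrite ?rmorph0 ?rmorphD ?rmorphM //.
    exact: ID.
  exact: IM.
exists [seq f g | g <- gs]; first by move=> _ /mapP[g ggs ->]; apply: gI.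
by move=> c; have [b ->] := surj c; move/Igs/(span_map f).
Qed.

Section Hilbert.
Variables (B : comNzRingType) (I : {poly B} -> Prop).
Hypotheses (fgB : all_ideals_fg B) (II : is_ideal I).

(** The ideal of leading coefficients of the elements of [I] of degree [n], together with 0. *)
Let top n (b : B) : Prop := exists p, [/\ I p, (size p <= n.+1)%N & p`_n = b].

Let top_ideal n : is_ideal (top n).
Proof.
have [I0 ID IM] := II; split.
- by exists 0; rewrite size_poly0 coef0.
- move=> _ _ [p [Ip sp <-]] [q [Iq sq <-]]; exists (p + q); split.
  + exact: ID.
  + by rewrite (leq_trans (size_polyD _ _)) // geq_max sp.
  + by rewrite coefD.
- move=> a _ [p [Ip sp <-]]; exists (a%:P * p); split.
  + exact: IM.
  + by rewrite mul_polyC (leq_trans (size_scale_leq _ _)).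
  + by rewrite coefCM.
Qed.

Let topS m n b : (m <= n)%N -> top m b -> top n b.
Proof.
have [I0 ID IM] := II; move=> mn [p [Ip sp <-]]; exists ('X^(n - m) * p); split.
- exact: IM.
- by apply: leq_trans (size_polyMleq _ _) _; rewrite size_polyXn; lia.
- by rewrite coefXnM ltnNge leq_subr /= subKn.
Qed.

Let lifts n gs : {in gs, forall g, top n g} ->
  exists2 G : seq {poly B}, [seq p`_n | p : {poly B} <- G] = gs &
    {in G, forall p, I p /\ (size p <= n.+1)%N}.
Proof.
elim: gs => [|g gs IH] gI; first by exists [::].
have [h hgs|G GE GI] := IH; first by apply: gI; rewrite inE hgs orbT.
have [p [Ip sp pE]] := gI g (mem_head _ _).
exists (p :: G) => /=; first by rewrite pE GE.
by move=> q; rewrite inE => /predU1P[->|/GI].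
Qed.

(** The ideals [top n] increase and become constant at some [N]. Lifts of generators of [top 0] to
    [top N] generate [I]: they allow the leading term of any element to be cancelled, which lowers
    its degree. *)
Lemma hilbert_basis : exists2 gs, {in gs, forall g, I g} & forall p, I p -> in_span gs p.
Proof.
have [I0 ID IM] := II.
have /choice[G GP] : forall n, exists G : seq {poly B},
    {in G, forall p, I p /\ (size p <= n.+1)%N} /\
    forall b, top n b -> in_span [seq p`_n | p : {poly B} <- G] b.
  move=> n; have [gs gI Igs] := fgB (top_ideal n).
  by have [G GE GI] := lifts gI; exists G; rewrite GE.
(* The union of the [top n] is finitely generated, and its generators all occur at a finite
   stage. *)
have [N topN] : exists N, forall n b, top n b -> top N b.
  have [|gs gI Igs] := fgB (I := fun b => exists n, top n b).
    split; first by exists 0%N; case: (top_ideal 0).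
      move=> a b [m ma] [n nb]; exists (m + n)%N.
      have [_ D _] := top_ideal (m + n); apply: D.
        by apply: topS ma; rewrite leq_addr.
      by apply: topS nb; rewrite leq_addl.
    by move=> a b [m mb]; exists m; have [_ _ M] := top_ideal m; apply: M.
  have [N NP] : exists N, {in gs, forall g, top N g}.
    elim: (gs) gI => [|g l IH] gI; first by exists 0%N.
    have [h hl|N NP] := IH; first by apply: gI; rewrite inE hl orbT.
    have [n ng] := gI g (mem_head _ _); exists (n + N)%N => h.
    rewrite inE => /predU1P[->|/NP hN]; first by apply: topS ng; rewrite leq_addr.
    by apply: topS hN; rewrite leq_addl.
  exists N => n b nb; apply: span_sub (top_ideal N) NP _.
  by apply: Igs; exists n.
pose gs := flatten [seq G i | i <- iota 0 N.+1].
exists gs => [g /flattenP[_ /mapP[i _ ->]]|p Ip]; first by case/(GP i).1.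
have [J0 JD JM] := span_ideal gs.
elim: {p}(size p) {-2}p (leqnn (size p)) Ip => [|m IH] p sp Ip.
  by move: sp; rewrite leqn0 size_poly_eq0 => /eqP->.
pose n := minn m N; have nm : (n <= m)%N by apply: geq_minl.
have nN : (n <= N)%N by apply: geq_minr.
have topm : top m p`_m by exists p.
have : top n p`_m.
  by rewrite /n /minn; case: ifP => // _; apply: topN topm.
move/(GP n).2 => -[c pE]; rewrite size_map in c pE.
pose h : {poly B} := \sum_(i < size (G n)) (c i)%:P * 'X^(m - n) * (G n)`_i.
have hs : in_span gs h.
  apply: ideal_sum => // i _; apply: JM; apply: mem_span; apply/flattenP.
  exists (G n); last exact: mem_nth.
  by apply: map_f; rewrite mem_iota add0n ltnS.
have Ih : I h.
  by apply: ideal_sum => // i _; apply: IM; apply: (((GP n).1 _ (mem_nth _ _)).1).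
rewrite -(subrK h p); apply: JD => //; apply: IH; last exact: ideal_sub.
apply/leq_sizeP => j mj; rewrite coefB.
have sG (i : 'I_(size (G n))) : (size ((G n)`_i)%R <= n.+1)%N.
  exact: ((GP n).1 _ (mem_nth _ (ltn_ord i))).2.
have hj : h`_j = \sum_(i < size (G n)) c i * (G n)`_i`_(j - (m - n)).
  rewrite coef_sum; apply: eq_bigr => i _; rewrite -mulrA coefCM coefXnM.
  by rewrite ltnNge (leq_trans (leq_subr _ _) mj).
case: (ltngtP m j) mj => // [mj _|mjE _].
  rewrite [p`_j]nth_default ?(leq_trans sp) // hj big1 ?subr0 // => i _.
  by rewrite nth_default ?mulr0 // (leq_trans (sG i)) //; lia.
rewrite hj -mjE subKn // pE; apply/eqP; rewrite subr_eq0; apply/eqP.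
by apply: eq_bigr => i _; rewrite (nth_map 0).
Qed.

End Hilbert.

Lemma all_ideals_fg_poly B : all_ideals_fg B -> all_ideals_fg {poly B}.
Proof. by move=> fgB I II; apply: hilbert_basis. Qed.

Lemma all_ideals_fg_gen (A : comNzRingType) l (P : comNzRingType)
    (f : {rmorphism P -> A}) :
  all_ideals_fg P -> (forall a, ring_gen l f a) -> all_ideals_fg A.
Proof.
elim: l P f => [|x l IH] P f fgP /= genA.
  exact: all_ideals_fg_image genA fgP.
by apply: IH genA; apply: all_ideals_fg_poly.
Qed.

Lemma edge_ring_gen (T : finType) (e : rel T) (K : fieldType) (l : seq (edge_ring e K)) :
  (forall v, edge_var e K v \in l) -> forall a, ring_gen l (edge_const e K) a.
Proof.
move=> lP; apply: edge_ring_ind => [k|v|a b Ga Gb|a b Ga Gb].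
- exact: ring_gen_base.
- exact: ring_gen_mem.
- exact: (ring_gen_closed Ga Gb).1.
- exact: (ring_gen_closed Ga Gb).2.
Qed.

Lemma edge_ring_noetherian (T : finType) (e : rel T) (K : fieldType) :
  noetherian (edge_ring e K).
Proof.
apply: all_ideals_fg_noetherian.
apply: (@all_ideals_fg_gen _ [seq edge_var e K v | v <- enum T] _ (edge_const e K)).
  exact: all_ideals_fg_field.
by apply: edge_ring_gen => v; apply: map_f; rewrite mem_enum.
Qed.

End Noetherian.

(** * Zariski's lemma *)

Section Zariski.
Variable Q : fieldType.

(* The image of [f] becomes a field after inverting one element. *)
Definition goldman (P : comNzRingType) (f : {rmorphism P -> Q}) : Prop :=
  exists2 g, f g != 0 &
    forall b, f b != 0 -> exists c N, f b * f c = f g ^+ N.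

Section Step.
Variables (P : comNzRingType) (f : {rmorphism P -> Q}) (a : Q).
Local Notation fa := (horner_rmorph f a).

(* If [a] were transcendental and [F(a)] inverted everything, [1 + a F(a)]
   would divide a power of the coprime [F(a)]. *)
Lemma goldman_algebraic : goldman fa ->
  exists2 p : {poly P}, map_poly f p != 0 & root (map_poly f p) a.
Proof.
move=> [F F0 FG]; apply: contrapT => nalg.
have inj p : fa p = 0 -> map_poly f p = 0.
  move=> p0; apply/eqP/negPn/negP => pn; apply: nalg; exists p => //.
  by rewrite /root -horner_rmorphE p0.
pose mF := map_poly f F; have mF0 : mF != 0.
  by apply: contra F0 => /eqP mF0; rewrite horner_rmorphE -/mF mF0 horner0.
pose b : {poly P} := 1 + 'X * F.
have mb : map_poly f b = 1 + 'X * mF by rewrite rmorphD rmorph1 rmorphM /= map_polyX.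
have szb : (1 < size (map_poly f b))%N.
  rewrite mb addrC mulrC size_polyDl size_mulX // ?size_poly1.
    by rewrite ltnS lt0n size_poly_eq0.
  by rewrite ltnS lt0n size_poly_eq0.
have fb : fa b != 0.
  by apply: contraTneq szb => /inj->; rewrite size_poly0.
have [c [N bc]] := FG b fb.
have mbc : map_poly f b * map_poly f c = mF ^+ N.
  apply/eqP; rewrite -subr_eq0 -rmorphXn -rmorphM -rmorphB; apply/eqP/inj.
  by rewrite rmorphB rmorphM bc rmorphXn subrr.
have cop : coprimep (map_poly f b) mF.
  apply/Bezout_eq1_coprimepP; exists (1, - 'X) => /=.
  by rewrite mb; ring.
have := coprimep_expr N cop; rewrite -mbc coprimepMr => /andP[+ _].
by rewrite coprimepp => /eqP szb1; rewrite szb1 in szb.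
Qed.

Variables (p : {poly P}).
Hypotheses (p0 : map_poly f p != 0) (pa : root (map_poly f p) a).
(** Taken at the degree of the image of [p], since [f] may kill the leading coefficient of [p]
    itself. *)
Let cn := p`_(size (map_poly f p)).-1.
Let lc : f cn = lead_coef (map_poly f p).
Proof. by rewrite lead_coefE coef_map. Qed.

Let cn0 : f cn != 0.
Proof. by rewrite lc lead_coef_eq0. Qed.

Local Notation fc := (horner_rmorph f (f cn)^-1).

(** The morphism [fc] stands for the localization of [P] at [cn], over which the equation of [a] can
    be made monic. *)
Let integral_a : integralOver fc a.
Proof.
apply: (@integral_root_monic _ _ _ _ ((f cn)^-1 *: map_poly f p)).
- by rewrite monicE lead_coefZ -lc mulVf.
- by rewrite rootZ // invr_eq0.
apply/integral_poly => i; rewrite coefZ coef_map.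
rewrite (_ : _ * _ = fc ('X * (p`_i)%:P)); first exact: integral_id.
by rewrite rmorphM horner_rmorphX horner_rmorphC.
Qed.

Let integral_fa F : integralOver fc (fa F).
Proof.
rewrite horner_rmorphE; apply: integral_horner => //.
apply/integral_poly => i.
rewrite (_ : (map_poly f F)`_i = fc (F`_i)%:P); first exact: integral_id.
by rewrite coef_map horner_rmorphC.
Qed.

Let clear_denominators q : integralOver fc q -> exists N r (u : nat -> P),
  f cn ^+ N * q ^+ r = \sum_(j < r) f (u j) * q ^+ j.
Proof.
case=> m mon_m /rootP mq.
pose r := (size m).-1; pose N := (\max_(j < size m) size (m`_j)%R)%N.
have rm : size m = r.+1 by rewrite prednK // lt0n size_poly_eq0 monic_neq0.
have le_N j : (j < size m)%N -> (size (m`_j)%R <= N)%N.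
  by move=> jm; rewrite /N (bigmax_sup (Ordinal jm)).
pose w j := \sum_(i < N) (m`_j)`_i * cn ^+ (N - i).
have wE j : (j < size m)%N -> f cn ^+ N * fc m`_j = f (w j).
  move=> jm; rewrite horner_rmorphE (@horner_coef_wide _ N); last first.
    by apply: leq_trans (size_poly _ _) (le_N j jm).
  rewrite mulr_sumr rmorph_sum; apply: eq_bigr => i _.
  rewrite coef_map rmorphM rmorphXn mulrCA; congr (_ * _).
  rewrite exprVn -{1}(subnK (ltnW (ltn_ord i))) exprD mulfK //.
  by rewrite expf_neq0.
exists N, r, (fun j => - w j).
have : f cn ^+ N * (map_poly fc m).[q] = 0 by rewrite mq mulr0.
rewrite (@horner_coef_wide _ r.+1); last by rewrite -rm size_poly.
rewrite big_ord_recr /= coef_map /= -/r.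
have -> : m`_r = 1 by have := monicP mon_m; rewrite lead_coefE.
rewrite rmorph1 mul1r mulrDr addrC => /eqP; rewrite addr_eq0 => /eqP->.
rewrite mulr_sumr -sumrN; apply: eq_bigr => j _.
by rewrite coef_map mulrA wE ?rmorphN ?mulNr // rm (leq_trans (ltn_ord j)).
Qed.

(** After division by a power of [fa F], the lowest nonzero coefficient of the relation is a
    multiple of [fa F]. *)
Let lowest_coefficient F r (w : nat -> P) : fa F != 0 ->
  \sum_(j < r) f (w j) * fa F ^+ j = 0 ->
  (exists2 j, (j < r)%N & f (w j) != 0) ->
  exists2 e, f e != 0 & exists g, f e = fa F * fa g.
Proof.
move=> F0; elim: r w => [|r IH] w; first by move=> _ [].
rewrite big_ord_recl expr0 mulr1 => sum0 [j jr wj].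
have sumE : \sum_(i < r) f (w (lift ord0 i)) * fa F ^+ lift ord0 i
    = fa F * \sum_(i < r) f (w i.+1) * fa F ^+ i.
  by rewrite mulr_sumr; apply: eq_bigr => i _; rewrite mulrCA -exprS.
rewrite sumE in sum0.
case: (eqVneq (f (w 0%N)) 0) => [w0|w0].
  apply: (IH (fun i => w i.+1)).
    move: sum0; rewrite w0 add0r => /eqP; rewrite mulf_eq0 (negPf F0) /=.
    by move/eqP.
  case: j jr wj => [|j] jr wj; first by rewrite w0 eqxx in wj.
  by exists j.
exists (w 0%N) => //; exists (- \sum_(i < r) (w i.+1)%:P * F ^+ i).
move/eqP: sum0; rewrite addr_eq0 => /eqP->; rewrite rmorphN rmorph_sum mulrN.
congr (- (_ * _)); apply: eq_bigr => i _.
by rewrite rmorphM rmorphXn horner_rmorphC.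
Qed.

(** The element to invert is [cn * e], with [e] in the base a multiple of [F]. A nonzero [b] divides
    a power of [F], hence [f e ^+ M = f b * y] with [y] integral over the localization at [cn].
    Multiplying the equation of [y], cleared of denominators, by the [r]-th power of [b] shows that
    [b] divides a product of powers of [cn] and [e] in the base. *)
Lemma goldman_descent : goldman fa -> goldman f.
Proof.
move=> [F F0 FG].
have [e e0 [g eE]] : exists2 e, f e != 0 & exists g, f e = fa F * fa g.
  have [N [r [u uE]]] := clear_denominators (integral_fa F).
  apply: (@lowest_coefficient F r.+1 (fun j => if (j < r)%N then u j else - cn ^+ N)) => //.
    rewrite big_ord_recr /= ltnn rmorphN rmorphXn mulNr uE.
    apply/eqP; rewrite subr_eq0; apply/eqP.
    by apply: eq_bigr => i _; rewrite ltn_ord.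
  by exists r => //; rewrite ltnn rmorphN oppr_eq0 rmorphXn expf_neq0.
exists (cn * e); first by rewrite rmorphM mulf_neq0.
move=> b b0; have [c [M bc]] : exists c M, fa b%:P * fa c = fa F ^+ M.
  by apply: FG; rewrite horner_rmorphC.
have [N [r [u uE]]] := clear_denominators (integral_fa (c * g ^+ M)).
set y := fa (c * g ^+ M) in uE.
have ey : f e ^+ M = f b * y.
  rewrite eE exprMn -bc horner_rmorphC /y rmorphM rmorphXn; ring.
pose d := \sum_(j < r) u j * e ^+ (M * j) * b ^+ (r - j.+1).
have dE : f cn ^+ N * f e ^+ (M * r) = f b * f d.
  rewrite exprM ey exprMn mulrCA uE mulr_sumr [in RHS]rmorph_sum mulr_sumr.
  apply: eq_bigr => j _; rewrite !rmorphM !rmorphXn exprM ey exprMn.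
  rewrite -{1}(subnKC (ltn_ord j)) exprD exprS; ring.
(* The extra factors bring the exponents of [cn] and [e], which are [N] and [M * r], to their common
   value [N + M * r]. *)
exists (d * cn ^+ (M * r) * e ^+ N), (N + M * r)%N.
rewrite !rmorphM !rmorphXn !mulrA -dE exprMn !exprD; ring.
Qed.

End Step.

Lemma goldman_step (P : comNzRingType) (f : {rmorphism P -> Q}) a :
  goldman (horner_rmorph f a) -> goldman f.
Proof.
by move=> Ga; have [p p0 pa] := goldman_algebraic Ga; apply: goldman_descent p0 pa Ga.
Qed.

Lemma goldman_gen l (P : comNzRingType) (f : {rmorphism P -> Q}) :
  (forall q, ring_gen l f q -> q != 0 -> ring_gen l f q^-1) -> goldman f.
Proof.
elim: l P f => [|x l IH] P f /= inv; last exact: goldman_step (IH _ _ inv).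
exists 1 => [|b b0]; first by rewrite rmorph1 oner_neq0.
have [|c cE] := inv (f b) _ b0; first by exists b.
by exists c, 1%N; rewrite -cE mulfV // rmorph1 expr1.
Qed.

(** Adjoining [q] as a first generator does not change [S]. As [S] is closed under inverses,
    [goldman_gen] applies over the polynomials in [q], and [goldman_algebraic] then makes [q]
    algebraic over [K]. *)
Lemma zariski_lemma (K : fieldType) (f : {rmorphism K -> Q}) (l : seq Q) (S : Q -> Prop) :
  (forall q, S q <-> ring_gen l f q) -> (forall q, S q -> q != 0 -> S q^-1) ->
  forall q, S q -> exists2 p : {poly K}, p != 0 & (map_poly f p).[q] = 0.
Proof.
move=> SE Sinv q Sq.
have SqE r : S r <-> ring_gen l (horner_rmorph f q) r.
  split; last first.
    move: r; apply: ring_gen_sub => [p|x xl|a b|a b].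
    - rewrite horner_rmorphE; elim/poly_ind: p => [|p c Sp].
        rewrite rmorph0 horner0; apply/SE; rewrite -(rmorph0 f).
        exact: ring_gen_base.
      rewrite rmorphD rmorphM /= map_polyX map_polyC !hornerE.
      apply/SE; apply: (ring_gen_closed _ _).1; last exact: ring_gen_base.
      by apply: (ring_gen_closed _ _).2; apply/SE.
    - by apply/SE/ring_gen_mem.
    - by move=> /SE Sa /SE Sb; apply/SE/(ring_gen_closed Sa Sb).1.
    - by move=> /SE Sa /SE Sb; apply/SE/(ring_gen_closed Sa Sb).2.
  move/SE; move: r; apply: ring_gen_sub => [c|x xl|a b Ga Gb|a b Ga Gb].
  - by rewrite -(horner_rmorphC f q); apply: ring_gen_base.
  - exact: ring_gen_mem.
  - exact: (ring_gen_closed Ga Gb).1.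
  - exact: (ring_gen_closed Ga Gb).2.
have [p p0 /rootP pq] : exists2 p : {poly K}, map_poly f p != 0 & root (map_poly f p) q.
  apply: goldman_algebraic; apply: (@goldman_gen l) => r /SqE Sr r0.
  by apply/SqE; apply: Sinv.
by exists p => //; apply: contra p0 => /eqP->; rewrite rmorph0.
Qed.

End Zariski.

(** * Cohen-Macaulayness of disjoint unions of cliques *)

Section ResidueField.
Variables (A : comNzRingType) (M : {pred A}).
Hypothesis Mmax : maximal_ideal M.

Lemma residue_field : exists (Q : fieldType) (f : {rmorphism A -> Q}),
  (forall a, (a \in M) = (f a == 0)) /\ forall q, exists a, q = f a.
Proof.
have [Mc _] := Mmax.
pose I : idealr A := HB.pack M (isIdealr.Build A M Mc).
pose B : comNzRingType := {ideal_quot I}.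
pose f : {rmorphism A -> B} := \pi_B%qT.
have surj b : exists a, b = f a by exists (repr b); rewrite /f /= reprK.
have ker a : (a \in M) = (f a == 0).
  have := Quotient.idealrBE I a 0; rewrite subr0 => aM.
  by rewrite -(rmorph0 f); apply: aM.
have /choice[inv invP] : forall b : B, exists c, if b == 0 then c = 0 else c * b = 1.
  move=> b; have [a ->] := surj b; case: (eqVneq (f a) 0) => [_|]; first by exists 0.
  rewrite -ker => aM; have [c cP] := maximal_ideal_inv Mmax aM; exists (f c).
  apply/eqP; rewrite eq_sym -subr_eq0 -rmorphM -(rmorph1 f) -rmorphB -ker.
  by rewrite mulrC.
have mulV (x : B) : x != 0 -> inv x * x = 1.
  by move=> /negPf x0; have := invP x; rewrite x0.
have inv0 : inv 0 = 0 by have := invP 0; rewrite eqxx.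
pose Q : fieldType := HB.pack B (GRing.ComNzRing_isField.Build B mulV inv0).
by exists Q, f.
Qed.

End ResidueField.

Lemma edge_residue_algebraic (T : finType) (e : rel T) (K Q : fieldType)
    (f : {rmorphism edge_ring e K -> Q}) : (forall q, exists a, q = f a) ->
  forall q, exists2 p : {poly K}, p != 0 & (map_poly (f \o edge_const e K) p).[q] = 0.
Proof.
move=> surj q; pose l := [seq f (edge_var e K v) | v <- enum T].
apply: (@zariski_lemma _ _ (f \o edge_const e K) l (fun=> True)) => // r.
split=> // _; have [a ->] := surj r.
elim/edge_ring_ind: a => [c|v|a b Ga Gb|a b Ga Gb].
- exact: (ring_gen_base l (f \o edge_const e K)).
- by apply/ring_gen_mem/map_f; rewrite mem_enum.
- by rewrite rmorphD; apply: (ring_gen_closed Ga Gb).1.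
- by rewrite rmorphM; apply: (ring_gen_closed Ga Gb).2.
Qed.

(** Descending induction on [k]: with [n] the degree of [p], the coefficient of index [k + n] in
    [p * q] is that of index [k] in [q] plus multiples of higher coefficients of [q]. *)
Lemma monic_coef_ideal (A : comNzRingType) (J : A -> Prop) (p q : {poly A}) :
  is_ideal J -> p \is monic -> (forall k, J (p * q)`_k) -> forall k, J q`_k.
Proof.
move=> JI pm Jpq; have [J0 JD JM] := JI; pose n := (size p).-1.
have pn : p`_n = 1 by have := monicP pm; rewrite lead_coefE.
have step m k : (size q <= k + m)%N -> J q`_k.
  elim: m k => [|m IH] k qk.
    by rewrite nth_default //; rewrite addn0 in qk.
  have nk : (n < (k + n).+1)%N by rewrite ltnS leq_addl.
  have := Jpq (k + n)%N; rewrite coefM (bigD1 (Ordinal nk)) //= pn mul1r addnK.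
  set r := \sum_(_ < _ | _) _ => Jr; rewrite -(addrK r q`_k).
  apply: ideal_sub => //; apply: ideal_sum => // i ni.
  case: (ltngtP i n) => [lt|gt|ieq].
  - apply/JM/IH; have := ltn_ord i; lia.
  - rewrite nth_default ?mul0r //; exact: leq_trans (leqSpred _) gt.
  - by case/eqP: ni; apply/val_inj.
by move=> k; apply: (step (size q)); rewrite leq_addl.
Qed.

Section ClusterCohenMacaulay.
Variables (T C : finType) (e : rel T) (c : T -> C) (K : fieldType).
Hypothesis eE : forall x y, e x y = (x != y) && (c x == c y).
Local Notation A := (edge_ring e K).
Local Notation c_ := (edge_const e K).
Local Notation x_ := (edge_var e K).

Definition class_sum z : A := \sum_(w | c w == z) x_ w.

(* [A] is the polynomial ring over the subring of the other classes, modulo the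
   products inside the class [z]; these are its branches. *)
Lemma class_branch v : exists f : {rmorphism A -> {poly A}},
  (forall k, f (c_ k) = (c_ k)%:P) /\
  forall w, f (x_ w) = if c w == c v then (if w == v then 'X else 0) else (x_ w)%:P.
Proof.
pose y w : {poly A} := if c w == c v then (if w == v then 'X else 0) else (x_ w)%:P.
have [u w euw|f [fc fx]] := edge_ring_lift (e := e) (@polyC A \o c_) (g := y).
  have uw0 : (x_ u)%:P * (x_ w)%:P = 0 :> {poly A}.
    by rewrite -polyCM (edge_var_mul K euw).
  move: euw; rewrite eE => /andP[uw /eqP cuw].
  rewrite /y -cuw.
  case: (c u == c v); last exact: uw0.
  case: eqP => [uv|_]; last by rewrite mul0r.
  by rewrite -uv eq_sym (negPf uw) mulr0.
by exists f.
Qed.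

(** On variables of the class [z], [E v] keeps only [x_ v] and [E0] keeps none. The identity is
    preserved by products because [E v a - E0 a] is a multiple of [x_ v], and the variables of
    distinct vertices in one class annihilate each other. *)
Lemma branch_decomposition z (E : T -> {rmorphism A -> A}) (E0 : {rmorphism A -> A}) :
  (forall k, E0 (c_ k) = c_ k) ->
  (forall w, E0 (x_ w) = if c w == z then 0 else x_ w) ->
  (forall v k, E v (c_ k) = c_ k) ->
  (forall v w, c v = z -> E v (x_ w) = if (c w == z) && (w != v) then 0 else x_ w) ->
  (forall v a, c v = z -> exists b, E v a = E0 a + x_ v * b) ->
  forall a, a = E0 a + \sum_(v | c v == z) (E v a - E0 a).
Proof.
move=> E0c E0x Ec Ex Eb; apply: edge_ring_ind => [k|w|a b aE bE|a b aE bE].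
- by rewrite E0c big1 ?addr0 // => v _; rewrite Ec subrr.
- rewrite E0x; case: (eqVneq (c w) z) => [cw|cw].
    rewrite add0r (bigD1 w) /= ?cw // Ex // cw !eqxx subr0 big1 ?addr0 // => v.
    by case/andP => /eqP cv vw; rewrite Ex // cw eqxx eq_sym vw subrr.
  by rewrite big1 ?addr0 // => v /eqP cv; rewrite Ex // (negPf cw) subrr.
- rewrite {1}aE {1}bE !rmorphD addrACA -big_split /=; congr (_ + _).
  by apply: eq_bigr => v _; rewrite rmorphD opprD addrACA.
rewrite {1}aE {1}bE !rmorphM.
set sa := \sum_(v | _) (E v a - _); set sb := \sum_(v | _) (E v b - _).
have sasb : sa * sb = \sum_(v | c v == z) (E v a - E0 a) * (E v b - E0 b).
  rewrite mulr_suml; apply: eq_bigr => v /eqP cv.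
  rewrite mulr_sumr (bigD1 v) /= ?cv // big1 ?addr0 // => w /andP[/eqP cw wv].
  have [a' ->] := Eb v a cv; have [b' ->] := Eb w b cw.
  rewrite addrC addKr [X in _ * X]addrC addKr mulrACA edge_var_mul ?mul0r //.
  by rewrite eE eq_sym wv cv cw eqxx.
have -> : \sum_(v | c v == z) (E v (a * b) - E0 a * E0 b)
    = sa * E0 b + E0 a * sb + sa * sb.
  rewrite sasb /sa /sb mulr_suml mulr_sumr -!big_split /=; apply: eq_bigr => v _.
  by rewrite rmorphM; ring.
by ring.
Qed.

(** On each branch the class sum becomes ['X], and a monic polynomial in ['X] can be cancelled
    modulo [J]. So the branches of [a] have coefficients in [J], and [branch_decomposition]
    reassembles [a] from them. *)
Lemma class_sum_regular (J : A -> Prop) v (p : {poly K}) : is_ideal J -> p \is monic ->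
  (forall w (f : {rmorphism A -> {poly A}}), c w = c v ->
    (forall k, f (c_ k) = (c_ k)%:P) ->
    (forall u, f (x_ u) = if c u == c w then (if u == w then 'X else 0) else (x_ u)%:P) ->
    forall a, J a -> forall k, J (f a)`_k) ->
  forall a, J ((map_poly c_ p).[class_sum (c v)] * a) -> J a.
Proof.
move=> JI pm Jbranch a Ja; have [J0 JD JM] := JI; pose z := c v.
have /choice[f fP] := class_branch.
have Jf w k : c w = z -> J (f w a)`_k.
  move=> cw; apply: (@monic_coef_ideal _ _ (map_poly c_ p)) => //.
    exact: monic_map.
  move=> {}k; have := Jbranch w (f w) cw (fP w).1 (fP w).2 _ Ja k.
  rewrite rmorphM -horner_map /= -map_poly_comp.
  have -> : f w (class_sum (c v)) = 'X.
    rewrite rmorph_sum (bigD1 w) /= ?cw // (fP w).2 !eqxx big1 ?addr0 // => u.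
    by case/andP => /eqP cu uw; rewrite (fP w).2 cu cw eqxx (negPf uw).
  rewrite (eq_map_poly (g := polyC \o c_)) => [|x /=]; last exact: (fP w).1.
  by rewrite map_poly_comp -[_.['X]]/(_ \Po 'X) comp_polyXr.
have [|E0 [E0c E0x]] := edge_ring_lift (e := e) c_
    (g := fun w => if c w == z then 0 else x_ w).
  move=> u w euw; case: ifP => _; rewrite ?mul0r //.
  by case: ifP => _; rewrite ?mulr0 // edge_var_mul.
pose E w : {rmorphism A -> A} := horner_eval (x_ w) \o f w.
have Ec w k : E w (c_ k) = c_ k by rewrite /= (fP w).1 /horner_eval hornerC.
have E00 w b : c w = z -> (f w b).[0] = E0 b.
  move=> cw; apply: (eq_edge_morph (f := horner_eval 0 \o f w) (g := E0)) => [k|u] /=.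
    by rewrite (fP w).1 /horner_eval hornerC.
  rewrite (fP w).2 /horner_eval E0x cw; case: ifP => _; last by rewrite hornerC.
  by case: ifP => _; rewrite ?hornerX ?horner0.
have Eb w b : c w = z -> exists b', E w b = E0 b + x_ w * b'.
  move=> cw; rewrite -(E00 w b cw) /= /horner_eval.
  elim/poly_ind: (f w b) => [|q k _]; first by exists 0; rewrite !horner0 mulr0 addr0.
  by exists q.[x_ w]; rewrite !hornerE; ring.
have aE := branch_decomposition (E := E) E0c E0x Ec _ Eb a.
have JE0 : J (E0 a).
  by rewrite -(E00 v) // horner_coef0; apply: Jf.
have JE w : c w = z -> J (E w a).
  move=> cw; rewrite /= /horner_eval horner_coef; apply: ideal_sum => // i _.
  by apply: ideal_mulr => //; apply: Jf.
rewrite aE => [|w u cw]; last first.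
  rewrite /= (fP w).2 /horner_eval cw.
  case: ifP => _ /=; last by rewrite hornerC.
  by case: eqP => [->|_]; rewrite ?hornerX ?horner0.
apply: JD => //; apply: ideal_sum => // w /eqP cw.
by apply: ideal_sub => //; apply: JE.
Qed.

Local Notation Z := (c @: setT).

(** The elements already used come from other classes and are constants on the branches of the
    current one, so their span is compatible with taking coefficients. *)
Lemma class_sum_regular_seq (p : C -> {poly K}) : (forall z, p z \is monic) ->
  forall i s, s = [seq (map_poly c_ (p z)).[class_sum z] | z <- enum Z] ->
  (i < size s)%N -> forall a, in_span (take i s) (s`_i * a) -> in_span (take i s) a.
Proof.
move=> pm i s sE; rewrite sE size_map -cardE => iZ a; rewrite -sE.
have [z0 _] : exists z0, z0 \in Z by apply/card_gt0P; lia.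
pose z := nth z0 (enum Z) i.
have si : s`_i = (map_poly c_ (p z)).[class_sum z].
  by rewrite sE (nth_map z0) // -cardE.
have /imsetP[v _ zv] : z \in Z by rewrite -mem_enum mem_nth // -cardE.
have JI := span_ideal (take i s); have [J0 JD JM] := JI.
rewrite si zv; apply: (class_sum_regular JI) => // w f cw fc fx b Jb.
apply: (span_sub (I := fun b => forall k, in_span (take i s) (f b)`_k) _ _ Jb).
  split=> [k|b1 b2 J1 J2 k|b1 b2 J2 k].
  - by rewrite rmorph0 coef0.
  - by rewrite rmorphD coefD; apply: JD.
  - by rewrite rmorphM coefM; apply: ideal_sum => // j _; apply: JM.
move=> g gs k.
have : g \in [seq (map_poly c_ (p z)).[class_sum z] | z <- take i (enum Z)].
  by rewrite map_take -sE.
case/mapP => z' z'i gE.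
have z'z : z' != c w.
  rewrite cw -zv; apply/eqP => z'z; have := take_uniq i.+1 (enum_uniq Z).
  by rewrite (take_nth z0) -?cardE // -/z rcons_uniq -z'z z'i.
have fg : f g = g%:P.
  have ft : f (class_sum z') = (class_sum z')%:P.
    rewrite !rmorph_sum; apply: eq_bigr => u /eqP cu.
    by rewrite fx cu (negPf z'z).
  rewrite gE -horner_map /= ft -map_poly_comp.
  rewrite (eq_map_poly (g := polyC \o c_)) => [|x /=]; last exact: fc.
  by rewrite map_poly_comp horner_map.
rewrite fg coefC; case: eqP => // _; exact: mem_span.
Qed.

Lemma cluster_cohen_macaulay : cohen_macaulay_graph e K.
Proof.
have e_irr : irreflexive e by move=> x; rewrite eE eqxx.
have le_alpha (F : {set T}) : independent e F -> (#|F| <= #|Z|)%N.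
  move/(cluster_independentP eE) => injF; rewrite -(card_in_imset injF).
  exact/subset_leq_card/imsetS/subsetT.
split=> [|M Mmax]; first exact: edge_ring_noetherian.
have [Mc _] := Mmax; have [Q [f [fM fsurj]]] := residue_field Mmax.
have falg := edge_residue_algebraic fsurj.
exists #|Z|; split.
- have /choice[p pP] : forall z, exists p : {poly K},
      p \is monic /\ (map_poly (f \o c_) p).[f (class_sum z)] = 0.
    move=> z; have [p p0 pz] := falg (f (class_sum z)).
    exists ((lead_coef p)^-1 *: p); split.
      by rewrite monicE lead_coefZ mulVf // lead_coef_eq0.
    by rewrite map_polyZ hornerZ pz mulr0.
  pose s := [seq (map_poly c_ (p z)).[class_sum z] | z <- enum Z].
  have sM : {subset s <= M}.
    move=> _ /mapP[z _ ->]; rewrite fM -horner_map /= -map_poly_comp.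
    exact/eqP/(pP z).2.
  exists s; last by rewrite size_map -cardE.
  split=> //; split.
    by move=> i si; apply: (@class_sum_regular_seq p (fun z => (pP z).1) i s).
  move=> s1; have [_ /negP + _] := Mc; apply.
  exact: (span_sub (idealr_closed_ideal Mc) sM s1).
- by move=> s [reg _]; apply: (edge_regular_bound e_irr le_alpha).
(* Adjacent variables have product 0, so one of them dies in the residue field. A maximal
   independent set containing the surviving vertices has [#|Z|] elements and yields the chain of
   primes. *)
- have ind0 : independent e [set v | x_ v \notin M].
    apply/independentP => u v; rewrite !inE !fM => fu fv; apply/negP => euv.
    by move/eqP: (congr1 f (edge_var_mul K euv));
      rewrite rmorphM rmorph0 mulf_eq0 (negPf fu) (negPf fv).
  have [F Fmax F0] := maxset_exists ind0.
  have [indF _] := maxsetP Fmax.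
  have [v vF|v _|P [Pp Ps PM]] := edge_prime_chain (f := f) indF.
  + apply/eqP; rewrite -fM; apply: contraNT vF => vM.
    by apply: (subsetP F0); rewrite inE.
  + exact: falg.
  rewrite (cluster_card eE Fmax) in Pp Ps PM.
  by exists P; split=> // a /PM; rewrite fM.
- by move=> d P; apply: (edge_chain_length e_irr le_alpha).
Qed.

End ClusterCohenMacaulay.

Theorem theorem3p9 (R : finUnitRingType) (K : fieldType) :
  (cohen_macaulay_graph (unitary_cayley R) K
   <-> well_covered (unitary_cayley R) /\ shellable_graph (unitary_cayley R))
  /\
  (well_covered (unitary_cayley R) /\ shellable_graph (unitary_cayley R)
   <-> is_field R \/
       exists2 k : nat, (0 < k)%N & ring_isomorphic R {ffun 'I_k -> 'Z_2}).
Proof.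
have e_sym := @unitary_cayley_sym R; have e_irr := @unitary_cayley_irr R.
set cm := cohen_macaulay_graph _ _; set wcs := _ /\ shellable_graph _.
set cls := _ \/ _.
have cm_cls : cm -> cls.
  by move/(cohen_macaulay_exchange e_sym e_irr)/exchange_classification.
have wcs_cls : wcs -> cls.
  by case=> wc sh; apply/exchange_classification/(shellable_exchange e_irr).
have cls_cm : cls -> cm.
  by move/classification_cluster => [C [c eE]]; apply: cluster_cohen_macaulay eE.
have cls_wcs : cls -> wcs.
  move/classification_cluster => [C [c eE]].
  by split; [apply: cluster_well_covered eE | apply: cluster_shellable eE].
by split; split; auto.
Qed.
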